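(* Let $A$ be a finite-dimensional elementary algebra over a finite field $k$ whose right Gabriel quiver is totally disconnected. Then there exists a noetherian ring $R$ such that the following properties hold: (i) The category of right $A$-modules of finite length and the category of right $R$-modules of finite length are equivalent. (ii) Both the category of right $A$-modules of finite length and the category of right $R$-modules of finite length have CSL. (iii) The category of all right $A$-modules has CSL, but the category of all right $R$-modules does not have CSL.
   Context: Rings are not necessarily commutative. A finite-dimensional $k$-algebra $A$ with Jacobson radical $\operatorname{rad}(A)$ is called elementary if $A/\operatorname{rad}(A)$ is a finite direct product of copies of $k$. A module category $\mathcal{C}$ (such as the category of all right modules over a ring, or the category of all right modules of finite length over a ring) ''has CSL'' (converse of Schur's Lemma) if every object of $\mathcal{C}$ whose endomorphism ring is a division ring is a simple module. The right Gabriel quiver (or right Ext-quiver) of a ring $B$ is the directed graph whose points are in bijective correspondence with the isomorphism classes of simple right $B$-modules, with an arrow $i \to j$ whenever the corresponding simple modules $S_i$ and $S_j$ satisfy $\operatorname{Ext}^1_B(S_i,S_j)\neq\{0\}$. It is called totally disconnected if there are no arrows between any two different points (loops are allowed). *)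

(* Defs.v *)
From HB Require Import structures.
From mathcomp Require Import all_boot all_order all_algebra all_field.
From mathcomp Require Import boolp classical_sets.

Set Implicit Arguments.
Unset Strict Implicit.
Unset Printing Implicit Defensive.

Import GRing.Theory.
Local Open Scope ring_scope.
Local Open Scope classical_set_scope.

(* A right module over a ring R is an lmodType over the converse ring R^c, the
   action x.r being written r *: x.  Everything below that does not mention R^c
   is stated for left modules and is meant to be used at both R and R^c. *)

Section Modules.
Variable R : nzRingType.
Implicit Types M : lmodType R.

Definition submodule M (N : set M) : Prop := submod_closed [in N].

(* N is a proper submodule of N' with N' / N simple. *)
Definition maximal_submodule M (N N' : set M) : Prop :=
  [/\ submodule N, submodule N', N `<` N' &
      forall K : set M, submodule K -> N `<=` K -> K `<=` N' ->
        K = N \/ K = N'].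

Definition simple_module M : Prop :=
  (exists x : M, x <> 0) /\
  (forall N : set M, submodule N -> N = [set 0] \/ N = setT).

(* Existence of a composition series. *)
Definition finite_length M : Prop :=
  exists (n : nat) (F : nat -> set M),
    [/\ F 0%N = [set 0], F n = setT &
        forall i, (i < n)%N -> maximal_submodule (F i) (F i.+1)].

Definition noetherian_module M : Prop :=
  forall F : nat -> set M,
    (forall i, submodule (F i)) -> (forall i, F i `<=` F i.+1) ->
    exists n, forall i, (n <= i)%N -> F i = F n.

Definition isomorphic_modules (M N : lmodType R) : Prop :=
  exists f : {linear M -> N}, bijective f.

(* The endomorphism ring has addition computed pointwise, with zero \0, and
   composition as product, with unit idfun. *)
Definition division_endomorphism_ring M : Prop :=
  (idfun : M -> M) <> \0 /\
  (forall f : {linear M -> M}, f <> \0 :> (M -> M) ->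
     exists g : {linear M -> M}, g \o f = idfun /\ f \o g = idfun).

(* The full subcategory of modules satisfying P has CSL. *)
Definition has_CSL (P : lmodType R -> Prop) : Prop :=
  forall M, P M -> division_endomorphism_ring M -> simple_module M.

Definition all_modules : lmodType R -> Prop := fun=> True.

End Modules.
Arguments finite_length {R} M.

Definition noetherian_ring (R : nzRingType) : Prop :=
  noetherian_module (R^o : lmodType R) /\
  noetherian_module ((R^c)^o : lmodType R^c).

Section Ext1.
Variables (R : nzRingType) (S T : lmodType R).

(* Short exact sequences 0 -> T -> E -> S -> 0. *)
Record extension := Extension {
  ext_mod : lmodType R;
  ext_inj : {linear T -> ext_mod};
  ext_proj : {linear ext_mod -> S};
  ext_inj_injective : injective ext_inj;
  ext_proj_surjective : forall s, exists e, ext_proj e = s;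
  ext_exact : forall e, ext_proj e = 0 <-> exists t, ext_inj t = e }.

Definition extension_equiv (E E' : extension) : Prop :=
  exists h : {linear ext_mod E -> ext_mod E'},
    h \o ext_inj E = ext_inj E' /\ ext_proj E' \o h = ext_proj E.

Definition split_inj (t : T) : (T * S)%type := (t, 0).
Definition split_proj (e : (T * S)%type) : S := e.2.

Fact split_inj_is_linear : linear split_inj.
Proof.
move=> a u v; apply: (congr1 (pair (a *: u + v))).
by rewrite /= scaler0 addr0.
Qed.
HB.instance Definition _ :=
  GRing.isLinear.Build R T (T * S)%type _ split_inj split_inj_is_linear.

Fact split_proj_is_linear : linear split_proj.
Proof. by []. Qed.
HB.instance Definition _ :=
  GRing.isLinear.Build R (T * S)%type S _ split_proj split_proj_is_linear.

Fact split_inj_injective : injective split_inj.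
Proof. by move=> t u []. Qed.

Fact split_proj_surjective s : exists e, split_proj e = s.
Proof. by exists (0, s). Qed.

Fact split_exact e : split_proj e = 0 <-> exists t, split_inj t = e.
Proof.
split=> [|[t <-]//]; case: e => t s; rewrite /split_proj /= => ->.
by exists t.
Qed.

Definition split_extension : extension :=
  Extension split_inj_injective split_proj_surjective split_exact.

(* Yoneda's Ext^1(S, T) is the group of equivalence classes of extensions, the
   class of the split extension being its zero. *)
Definition Ext1_nonzero : Prop :=
  exists E : extension, ~ extension_equiv E split_extension.

End Ext1.

(* The points of the Gabriel quiver are the simple modules up to isomorphism;
   they are represented here by the simple modules themselves. *)
Definition gabriel_arrow (R : nzRingType) (S T : lmodType R) : Prop :=
  [/\ simple_module S, simple_module T & Ext1_nonzero S T].

Definition right_quiver_totally_disconnected (B : nzRingType) : Prop :=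
  forall S T : lmodType B^c, gabriel_arrow S T -> isomorphic_modules S T.

(* The intersection of the maximal right ideals of R. *)
Definition jacobson_radical (R : nzRingType) : set R :=
  \bigcap_(I in [set I | @maximal_submodule R^c (R^c)^o I setT]) I.
Arguments jacobson_radical R : clear implicits.

(* A / rad(A) is isomorphic to the algebra k^n: there is a surjective
   homomorphism of k-algebras A -> k^n with kernel rad(A). *)
Definition elementary (k : fieldType) (A : falgType k) : Prop :=
  exists (n : nat) (f : {lrmorphism A -> {ffun 'I_n -> k^o} | *:%R}),
    (forall y, exists x, f x = y) /\
    (forall x, f x = 0 <-> jacobson_radical A x).

Record category := Category {
  Obj : Type;
  Hom : Obj -> Obj -> Type;
  idm : forall X, Hom X X;
  comp : forall X Y Z, Hom Y Z -> Hom X Y -> Hom X Z;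
  comp_idl : forall X Y (f : Hom X Y), comp (idm Y) f = f;
  comp_idr : forall X Y (f : Hom X Y), comp f (idm X) = f;
  comp_assoc : forall X Y Z W (h : Hom Z W) (g : Hom Y Z) (f : Hom X Y),
    comp h (comp g f) = comp (comp h g) f }.
Arguments Hom {c} _ _.
Arguments idm {c} X.
Arguments comp {c X Y Z} _ _.

Record functor (C D : category) := Functor {
  fobj : Obj C -> Obj D;
  fmap : forall X Y, Hom X Y -> Hom (fobj X) (fobj Y);
  fmap_id : forall X, fmap (idm X) = idm (fobj X);
  fmap_comp : forall X Y Z (g : Hom Y Z) (f : Hom X Y),
    fmap (comp g f) = comp (fmap g) (fmap f) }.
Arguments fobj {C D} f X : rename.
Arguments fmap {C D} f {X Y} _ : rename.

Definition isomorphism (C : category) (X Y : Obj C) (f : Hom X Y) : Prop :=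
  exists g : Hom Y X, comp g f = idm X /\ comp f g = idm Y.

Definition functor_id (C : category) : functor C C :=
  @Functor C C id (fun _ _ f => f) (fun=> erefl) (fun _ _ _ _ _ => erefl).

Section FunctorComp.
Variables (C D E : category) (G : functor D E) (F : functor C D).

Fact functor_comp_id X : fmap G (fmap F (idm X)) = idm (fobj G (fobj F X)).
Proof. by rewrite !fmap_id. Qed.

Fact functor_comp_comp X Y Z (g : Hom Y Z) (f : Hom X Y) :
  fmap G (fmap F (comp g f)) = comp (fmap G (fmap F g)) (fmap G (fmap F f)).
Proof. by rewrite !fmap_comp. Qed.

Definition functor_comp : functor C E :=
  @Functor C E (fun X => fobj G (fobj F X)) (fun _ _ f => fmap G (fmap F f))
    functor_comp_id functor_comp_comp.
End FunctorComp.

Definition naturally_isomorphic (C D : category) (F G : functor C D) : Prop :=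
  exists a : forall X, Hom (fobj F X) (fobj G X),
    (forall X, isomorphism (a X)) /\
    (forall X Y (f : Hom X Y), comp (a Y) (fmap F f) = comp (fmap G f) (a X)).

Definition equivalent_categories (C D : category) : Prop :=
  exists (F : functor C D) (G : functor D C),
    naturally_isomorphic (functor_comp G F) (functor_id C) /\
    naturally_isomorphic (functor_comp F G) (functor_id D).

Section ModuleCategory.
Variable R : nzRingType.

Lemma linear_ext (M N : lmodType R) (f g : {linear M -> N}) : f =1 g -> f = g.
Proof.
case: f g => [f [[f1] [f2]]] [g [[g1] [g2]]] /= /funext fg; subst g.
by rewrite (Prop_irrelevance f1 g1) (Prop_irrelevance f2 g2).
Qed.

Section Laws.
Variables M N K L : lmodType R.
Implicit Types (f : {linear M -> N}) (g : {linear N -> K}) (h : {linear K -> L}).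

Fact linear_comp_idl f : (idfun \o f : {linear M -> N}) = f.
Proof. exact: linear_ext. Qed.

Fact linear_comp_idr f : (f \o idfun : {linear M -> N}) = f.
Proof. exact: linear_ext. Qed.

Fact linear_comp_assoc h g f :
  (h \o (g \o f) : {linear M -> L}) = ((h \o g) \o f : {linear M -> L}).
Proof. exact: linear_ext. Qed.
End Laws.

(* The full subcategory of modules satisfying P. *)
Definition module_category (P : lmodType R -> Prop) : category :=
  @Category {M : lmodType R | P M}
    (fun M N => {linear sval M -> sval N})
    (fun M => idfun)
    (fun M N K g f => g \o f)
    (fun M N f => linear_comp_idl f)
    (fun M N f => linear_comp_idr f)
    (fun M N K L h g f => linear_comp_assoc h g f).
End ModuleCategory.

(* Main.v *)
(* Let K be the algebraic closure of k, sigma its Frobenius map x |-> x ^+ #|k|,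
   and R = A (x)_k K[x, x^-1; sigma].  By the Lang-type descent for sigma, an
   R-module of finite length is spanned over K by its vectors fixed by x, and
   M |-> {v | x v = v} is an equivalence with the A-modules of finite length, with
   inverse X |-> X (x)_k K.  The division ring of fractions of K[x, x^-1; sigma],
   on which A acts through one of its characters, is an R-module that is not
   simple, and its endomorphisms form a division ring.
   On the side of A, the vanishing of Ext^1 between distinct simple modules makes
   the primitive idempotents central, so that a module M whose endomorphisms form a
   division ring lives over a single local block; there the top and the socle of M
   have a common simple constituent, hence M is simple. *)

From HB Require Import structures.
From mathcomp Require Import all_boot all_order all_algebra all_field.
From mathcomp Require Import boolp classical_sets functions.
From mathcomp Require Import ring zify.
Require Import Defs.

Set Implicit Arguments.
Unset Strict Implicit.
Unset Printing Implicit Defensive.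

Import GRing.Theory.
Local Open Scope ring_scope.
Local Open Scope classical_set_scope.

(** * Modules *)

(** Two kinds of equations over K drive the descent. In a simple subquotient, a vector fixed by x
    comes from a nonzero root z of the sum of the p_i sigma^i(z), because such a z makes the skew
    polynomial p(x) z divisible on the right by x - 1. Across an extension, a vector fixed only
    modulo a submodule is corrected by solving sigma(z) - z = c. Finiteness of k makes k the whole
    fixed field of sigma, so that fixed vectors have their coordinates in k. The same descent shows
    that the module of fractions is not simple: a simple module has finite length, hence a basis
    over K of vectors fixed by x, whereas x - 1 acts injectively on fractions. That module is cut
    out of the skew Laurent series, where dividing by a nonzero polynomial is a recursion on
    coefficients; no localization has to be built. The tensor product with K is not built either.
    The arguments about R use only generators and relations, and a concrete ring of operators
    satisfying them is supplied at the end. *)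

Section Submodules.
Variables (R : nzRingType) (M : lmodType R).
Implicit Types (N : set M) (u v : M).

Lemma submoduleP N :
  submodule N <-> N 0 /\ forall a u v, N u -> N v -> N (a *: u + v).
Proof.
split=> -[N0 Nlin]; split.
- by rewrite inE in N0.
- by move=> a u v Nu Nv; have := Nlin a u v (mem_set Nu) (mem_set Nv); rewrite inE.
- exact: mem_set.
- by move=> a u v /set_mem Nu /set_mem Nv; apply/mem_set/Nlin.
Qed.

Lemma submodule0 N : submodule N -> N 0.
Proof. by move=> /submoduleP[]. Qed.

Lemma submoduleZ N a u : submodule N -> N u -> N (a *: u).
Proof. by move=> /submoduleP[N0 NL] Nu; rewrite -[_ *: _]addr0; exact: NL. Qed.

Lemma submoduleD N u v : submodule N -> N u -> N v -> N (u + v).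
Proof. by move=> /submoduleP[_ NL] Nu Nv; rewrite -[u]scale1r; exact: NL. Qed.

Lemma submoduleN N u : submodule N -> N u -> N (- u).
Proof. by move=> sN Nu; rewrite -scaleN1r; exact: submoduleZ. Qed.

Lemma submoduleB N u v : submodule N -> N u -> N v -> N (u - v).
Proof. by move=> sN Nu Nv; apply: submoduleD => //; exact: submoduleN. Qed.

Lemma submoduleT : submodule [set: M].
Proof. by apply/submoduleP; split. Qed.

Lemma submodule_set0 : submodule [set (0 : M)].
Proof.
by apply/submoduleP; split=> // a u v /= -> ->; rewrite scaler0 addr0.
Qed.

Lemma submodule_subr N u v : submodule N -> N (u - v) -> N v -> N u.
Proof. by move=> sN Nuv Nv; rewrite -(subrK v u); exact: submoduleD. Qed.

Section Subtype.
Variables (N : set M) (sN : submodule N).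

(** The proof that [N] is a submodule is a phantom argument: the module structure attached to the
    type depends on it. *)
Definition submod_of of submodule N := {x : M | x \in N}.
Local Notation T := (submod_of sN).

HB.instance Definition _ := SubChoice.on T.

Fact submod_of_closed : submod_closed [in N].
Proof. exact: sN. Qed.

HB.instance Definition _ :=
  GRing.SubChoice_isSubLmodule.Build R M [in N] T submod_of_closed.

Definition submod_elt u (Nu : N u) : T := Sub u (mem_set Nu).

Lemma submod_eltK u (Nu : N u) : val (submod_elt Nu) = u.
Proof. by rewrite SubK. Qed.

Lemma submod_valP (w : T) : N (val w).
Proof. by apply/set_mem/(valP w). Qed.

End Subtype.

End Submodules.

Definition linear_map (R : nzRingType) (U V : lmodType R) (f : U -> V)
    (f_lin : linear f) : {linear U -> V} :=
  HB.pack f (GRing.isLinear.Build R U V _ f f_lin).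

Section Restriction.
Variables (R S : nzRingType) (j : {rmorphism R -> S}) (M : lmodType S).

(** The morphism is a phantom argument: the carrier is that of [M], and only the scaling depends on
    [j]. *)
Definition restriction of {rmorphism R -> S} : Type := M.
Local Notation T := (restriction j).

HB.instance Definition _ := GRing.Zmodule.on T.

Definition restriction_scale (a : R) (v : T) : T := j a *: (v : M).

Fact restriction_scaleA a b v :
  restriction_scale a (restriction_scale b v) = restriction_scale (a * b) v.
Proof. by rewrite /restriction_scale scalerA rmorphM. Qed.

Fact restriction_scale1 : left_id 1 restriction_scale.
Proof. by move=> v; rewrite /restriction_scale rmorph1 scale1r. Qed.

Fact restriction_scaleDr : right_distributive restriction_scale +%R.
Proof. by move=> a u v; rewrite /restriction_scale scalerDr. Qed.

Fact restriction_scaleDl v :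
  {morph restriction_scale^~ v : a b / a + b}.
Proof. by move=> a b; rewrite /restriction_scale rmorphD scalerDl. Qed.

HB.instance Definition _ := GRing.Zmodule_isLmodule.Build R T
  restriction_scaleA restriction_scale1 restriction_scaleDr
  restriction_scaleDl.

End Restriction.

(** * A numerical criterion for finite length *)

Section FiniteLength.
Variables (R : nzRingType) (M : lmodType R).

(** The series is built upwards: among the submodules strictly above [N], one with the least value
    of [d] has nothing strictly between itself and [N]. The gap between [d N] and the value of [d]
    at the whole module bounds the number of steps. *)
Lemma finite_length_dim (d : set M -> nat) (b : nat) :
  (forall N, submodule N -> (d N <= b)%N) ->
  (forall N N' : set M, submodule N -> submodule N' -> N `<` N' ->
    (d N < d N')%N) ->
  finite_length M.
Proof.
move=> d_le d_lt.
suff chain m (N : set M) : submodule N -> (d [set: M] - d N <= m)%N ->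
    exists (n : nat) (F : nat -> set M), [/\ F 0%N = N, F n = setT &
      forall i, (i < n)%N -> maximal_submodule (F i) (F i.+1)].
  exact: (chain _ [set 0] (@submodule_set0 _ _) (leqnn _)).
have NltT (K : set M) : K <> setT -> K `<` setT.
  by move=> KT; split=> // TK; apply: KT; apply/seteqP; split.
elim: m N => [|m IHm] N sN dN.
  exists 0%N, (fun=> N); split=> //; apply: contrapT => /NltT NltT'.
  have := d_lt N setT sN (@submoduleT _ _).
  by rewrite ltnNge -subn_eq0 -leqn0 dN => /(_ NltT').
have [NT|/NltT NltT'] := pselect (N = setT); first by exists 0%N, (fun=> N).
pose P n := `[< exists N' : set M, [/\ submodule N', N `<` N' & d N' = n] >].
have exP : exists n, P n.
  by exists (d setT); apply/asboolP; exists setT; split=> //; exact: submoduleT.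
have [n /asboolP[N' [sN' NN' dN']] n_min] := ex_minnP exP.
have maxN : maximal_submodule N N'.
  split=> // K sK NK KN'; have [KN|KN] := pselect (K = N); first by left.
  right; apply: contrapT => KN'e.
  have NltK : N `<` K.
    rewrite properEneq; split=> //.
    by apply/eqP => NKe; apply: KN.
  have KltN' : K `<` N'.
    by rewrite properEneq; split=> //; exact/eqP.
  have := d_lt _ _ sK sN' KltN'; rewrite ltnNge dN' n_min //.
  by apply/asboolP; exists K.
have [|n' [F [F0 Fn Fmax]]] := IHm N' sN'.
  have := d_lt _ _ sN sN' NN'.
  by move: dN; rewrite !leq_subLR => dN lt;
    rewrite (leq_trans dN) // addnS -addSn leq_add2r.
exists n'.+1, (fun i => if i is i'.+1 then F i' else N); split=> // -[|i] ltin.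
  by rewrite F0.
exact: Fmax.
Qed.

End FiniteLength.

(** * Linear algebra over a field of scalars inside the ring *)

Section Combinations.
Variables (F : fieldType) (S : nzRingType) (j : {rmorphism F -> S}).
Variables (M : lmodType S).

(** Coefficients act through [j], so [M] is treated as a vector space over [F] without receiving a
    second module structure. *)
Definition comb n (w : 'I_n -> M) (c : 'I_n -> F) : M :=
  \sum_i j (c i) *: w i.

Definition spans n (w : 'I_n -> M) (N : set M) : Prop :=
  forall v, N v <-> exists c, v = comb w c.

Definition free_family n (w : 'I_n -> M) : Prop :=
  forall c, comb w c = 0 -> forall i, c i = 0.

Lemma combD n (w : 'I_n -> M) c c' :
  comb w (fun i => c i + c' i) = comb w c + comb w c'.
Proof. by rewrite -big_split; apply: eq_bigr => i _; rewrite rmorphD scalerDl. Qed.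

Lemma combN n (w : 'I_n -> M) c : comb w (fun i => - c i) = - comb w c.
Proof. by rewrite -sumrN; apply: eq_bigr => i _; rewrite rmorphN scaleNr. Qed.

Lemma combZ n (w : 'I_n -> M) a c :
  comb w (fun i => a * c i) = j a *: comb w c.
Proof. by rewrite scaler_sumr; apply: eq_bigr => i _; rewrite rmorphM scalerA. Qed.

Lemma comb0 n (w : 'I_n -> M) : comb w (fun=> 0) = 0.
Proof. by rewrite /comb big1 // => i _; rewrite rmorph0 scale0r. Qed.

Lemma comb_delta n (w : 'I_n -> M) i : comb w (fun l => (l == i)%:R) = w i.
Proof.
rewrite /comb (bigD1 i) //= eqxx rmorph1 scale1r big1 ?addr0 // => l /negPf->.
by rewrite rmorph0 scale0r.
Qed.

Lemma free_family_inj n (w : 'I_n -> M) c c' :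
  free_family w -> comb w c = comb w c' -> c =1 c'.
Proof.
move=> w_free /eqP; rewrite -subr_eq0 -combN -combD => /eqP/w_free cc' i.
by apply/eqP; rewrite -subr_eq0 cc'.
Qed.

Definition cons_family (T : Type) n (m : T) (w : 'I_n -> T) (i : 'I_n.+1) : T :=
  oapp w m (unlift ord0 i).

Lemma comb_cons n m (w : 'I_n -> M) c :
  comb (cons_family m w) c =
  j (c ord0) *: m + comb w (fun i => c (lift ord0 i)).
Proof.
rewrite /comb big_ord_recl /cons_family unlift_none; congr (_ + _).
by apply: eq_bigr => i _; rewrite liftK.
Qed.

Lemma spans_cons n m (w : 'I_n -> M) (N N' : set M) : spans w N ->
  (forall v, N' v <-> exists a, N (v - j a *: m)) ->
  spans (cons_family m w) N'.
Proof.
move=> wN NN' v; rewrite NN'; split=> [[a /wN[c vc]]|[c ->]].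
  exists (cons_family a c); rewrite comb_cons /cons_family unlift_none /=.
  under [comb w _]eq_bigr do rewrite liftK.
  by rewrite -/(comb w c) -vc addrC subrK.
exists (c ord0); apply/wN; exists (fun i => c (lift ord0 i)).
by rewrite comb_cons addrC addKr.
Qed.

Lemma free_cons n m (w : 'I_n -> M) (N : set M) :
  spans w N -> free_family w -> ~ N m -> free_family (cons_family m w).
Proof.
move=> wN w_free Nm c; rewrite comb_cons => /eqP.
have [c0|c0] := eqVneq (c ord0) 0.
  rewrite c0 rmorph0 scale0r add0r => /eqP/w_free cl i.
  by case: (unliftP ord0 i) => [l ->|->].
rewrite addr_eq0 -combN => /eqP/(congr1 (GRing.scale (j (c ord0)^-1))).
rewrite scalerA -rmorphM mulVf // rmorph1 scale1r -combZ => mE.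
by case: Nm; apply/wN; eexists; exact: mE.
Qed.

(** The invariant given to [finite_length_dim] is the dimension of the preimage of [N] under the
    coefficient map [g] from F^n onto [M]. A vector of [N'] outside [N] has a preimage that raises
    the dimension. *)
Lemma finite_length_spans n (w : 'I_n -> M) :
  (forall v, exists c, v = comb w c) -> finite_length M.
Proof.
move=> w_span; pose g (c : 'rV[F]_n) := comb w (c 0).
have gZ a c c' : g (a *: c + c') = j a *: g c + g c'.
  rewrite /g -combZ -combD; apply: eq_bigr => i _; by rewrite !mxE.
have g0 : g 0 = 0 by rewrite -(comb0 w); apply: eq_bigr => i _; rewrite mxE.
pose inN (N : set M) (X : 'M[F]_n) :=
  forall c : 'rV[F]_n, (c <= X)%MS -> N (g c).
pose P N d := `[< exists2 X, inN N X & \rank X = d >].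
have exP N : submodule N -> exists d, P N d.
  move=> sN; exists 0%N; apply/asboolP; exists 0; last exact: mxrank0.
  by move=> c; rewrite submx0 => /eqP->; rewrite g0; exact: submodule0.
have leP N d : P N d -> (d <= n)%N.
  by move=> /asboolP[X _ <-]; exact: rank_leq_col.
(* The largest rank of a matrix whose row space [g] sends into [N]. The value 0 in the other branch
   is a default for sets that do not contain 0. *)
pose d N := if pselect (exists d, P N d) is left e then
  ex_maxn e (@leP N) else 0%N.
have dP N (sN : submodule N) : P N (d N) /\ forall d', P N d' -> (d' <= d N)%N.
  rewrite /d; case: pselect => [e|/(_ (exP N sN)) //].
  by case: ex_maxnP.
apply: (@finite_length_dim _ _ d n) => [N sN|N N' sN sN' NN'].
  exact/leP/(dP N sN).1.
have [v N'v Nv] : exists2 v, N' v & ~ N v.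
  by move: NN' => [_ /nonsubset[v [? ?]]]; exists v.
have [c gc] := w_span v.
have [/asboolP[X NX <-] _] := dP N sN.
pose cv : 'rV[F]_n := \row_i c i.
have gcv : g cv = v by rewrite gc; apply: eq_bigr => i _; rewrite mxE.
have cvX : ~~ (cv <= X)%MS.
  by apply/negP => /NX; rewrite gcv.
apply: leq_trans ((dP N' sN').2 (\rank (X + cv)%MS) _).
  rewrite ltnNge; apply: contra cvX => le.
  have /eqmxP/eqmx_sym XE : (X == X + cv)%MS.
    by rewrite -mxrank_leqif_eq ?addsmxSl // eqn_leq le mxrankS // addsmxSl.
  by rewrite -(eqmxP (introT eqmxP XE)) addsmxSr.
apply/asboolP; exists (X + cv)%MS => // c' /sub_addsmxP[[u1 u2] ->] /=.
have -> : u2 *m cv = u2 0 0 *: cv.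
  by rewrite [u2]mx11_scalar mul_scalar_mx mxE eqxx mulr1n.
rewrite addrC gZ; apply: submoduleD => //; first by apply: submoduleZ => //;
  rewrite gcv.
by apply: NN'.1; apply: NX; exact: submxMl.
Qed.

End Combinations.

(** The quasi-inverse chooses for each [Y] an object [F0 Y] and an isomorphism [e Y] from its image
    to [Y], and sends a morphism to the unique preimage of its conjugate by these isomorphisms.
    Uniqueness of preimages gives functoriality and naturality. *)
Lemma fully_faithful_equivalence (C D : category) (G : functor C D) :
  (forall X Y (h : Hom (fobj G X) (fobj G Y)), exists! f : Hom X Y, fmap G f = h) ->
  (forall Y, exists X (f : Hom (fobj G X) Y), isomorphism f) ->
  equivalent_categories D C.
Proof.
move=> ff es.
have [F0 F0P] := choice es.
pose e Y := sval (cid (F0P Y)); have eP Y : isomorphism (e Y) := svalP (cid (F0P Y)).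
pose e' Y := sval (cid (eP Y)).
have e'P Y : comp (e' Y) (e Y) = idm _ /\ comp (e Y) (e' Y) = idm _ :=
  svalP (cid (eP Y)).
have [lift liftP] : exists lift : forall X Y, Hom (fobj G X) (fobj G Y) -> Hom X Y,
    forall X Y h, fmap G (lift X Y h) = h /\ forall f, fmap G f = h -> lift X Y h = f.
  exists (fun X Y h => sval (cid (ff X Y h))) => X Y h.
  by case: cid => f /= [].
have liftG X Y h : fmap G (lift X Y h) = h by case: (liftP X Y h).
have lift_eq X Y (f f' : Hom X Y) : fmap G f = fmap G f' -> f = f'.
  by move=> E; case: (liftP X Y (fmap G f')) => _ L; rewrite -(L _ E) (L _ erefl).
have F1 Y : lift _ _ (comp (e' Y) (comp (idm Y) (e Y))) = idm (F0 Y).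
  by apply: lift_eq; rewrite liftG fmap_id comp_idl (e'P Y).1.
have Fc Y Y' Y'' (g : Hom Y' Y'') (f : Hom Y Y') :
    lift _ _ (comp (e' Y'') (comp (comp g f) (e Y))) =
    comp (lift _ _ (comp (e' Y'') (comp g (e Y'))))
         (lift _ _ (comp (e' Y') (comp f (e Y)))).
  apply: lift_eq; rewrite fmap_comp !liftG -!comp_assoc; congr comp.
  by congr comp; rewrite !comp_assoc (e'P _).2 comp_idl.
pose F := @Functor D C F0 (fun Y Y' f => lift _ _ (comp (e' Y') (comp f (e Y))))
  F1 Fc.
exists F, G; split.
  exists e; split=> [Y|Y Y' f]; first by exists (e' Y); exact: e'P.
  by rewrite /= liftG comp_assoc (e'P _).2 comp_idl.
exists (fun X => lift _ _ (e (fobj G X))); split=> [X|X X' f].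
  exists (lift _ _ (e' (fobj G X))).
  by split; apply: lift_eq; rewrite fmap_comp !liftG fmap_id; case: (e'P (fobj G X)).
by apply: lift_eq; rewrite /= !fmap_comp !liftG [LHS]comp_assoc (e'P _).2 comp_idl.
Qed.

(** * Elementary algebras *)

Definition scalar_op (k : fieldType) (A : falgType k) (c : k) : A^c := c%:A.

Section ScalarOp.
Variables (k : fieldType) (A : falgType k).

Fact scalar_op_additive : zmod_morphism (@scalar_op k A).
Proof. by move=> c d; rewrite /scalar_op scalerBl. Qed.

Fact scalar_op_multiplicative : monoid_morphism (@scalar_op k A).
Proof.
split=> [|c d]; rewrite /scalar_op; first exact: scale1r.
by rewrite [RHS](_ : _ = (d%:A * c%:A : A)) // mulr_algl scalerA mulrC.
Qed.

HB.instance Definition _ :=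
  GRing.isZmodMorphism.Build k A^c (@scalar_op k A) scalar_op_additive.
HB.instance Definition _ :=
  GRing.isMonoidMorphism.Build k A^c (@scalar_op k A) scalar_op_multiplicative.

Lemma scalar_op_central (c : k) (a : A^c) : scalar_op A c * a = a * scalar_op A c.
Proof.
rewrite [LHS](_ : _ = ((a : A) * c%:A)) // [RHS](_ : _ = (c%:A * (a : A))) //.
by rewrite mulr_algl mulr_algr.
Qed.

End ScalarOp.

Section Elementary.
Variables (k : fieldType) (A : falgType k) (n : nat).
Variable f : {lrmorphism A -> {ffun 'I_n -> k^o} | *:%R}.
Hypothesis f_surj : forall y, exists x, f x = y.
Hypothesis f_ker : forall x, f x = 0 <-> @jacobson_radical A x.
Implicit Types a b c : A.

Definition char_at (i : 'I_n) (a : A) : k := f a i.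

Lemma char_atD i a b : char_at i (a + b) = char_at i a + char_at i b.
Proof. by rewrite /char_at raddfD ffunE. Qed.

Lemma char_atN i a : char_at i (- a) = - char_at i a.
Proof. by rewrite /char_at raddfN ffunE. Qed.

Lemma char_atM i a b : char_at i (a * b) = char_at i a * char_at i b.
Proof. by rewrite /char_at rmorphM ffunE. Qed.

Lemma char_at1 i : char_at i 1 = 1.
Proof. by rewrite /char_at rmorph1 ffunE. Qed.

Lemma char_at0 i : char_at i 0 = 0.
Proof. by rewrite /char_at raddf0 ffunE. Qed.

Lemma char_atZ i (c : k) a : char_at i (c *: a) = c * char_at i a.
Proof. by rewrite /char_at linearZ ffunE. Qed.

Lemma char_at_alg i (c : k) : char_at i c%:A = c.
Proof. by rewrite char_atZ char_at1 mulr1. Qed.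

Lemma char_at_lift (i : 'I_n) : exists a, forall l, char_at l a = (l == i)%:R.
Proof.
by have [a fa] := f_surj [ffun l => (l == i)%:R]; exists a => l;
  rewrite /char_at fa ffunE.
Qed.

(** Taking the kernel of [f] presents the radical as a subspace, which gives access to its powers
    and to their dimensions. *)
Definition radical : {vspace A} := lker (linfun f).
Local Notation J := radical.

Lemma radicalP a : reflect (forall i, char_at i a = 0) (a \in J).
Proof.
rewrite memv_ker lfunE /=; apply: (iffP eqP) => [fa0 i|fa0].
  by rewrite /char_at fa0 ffunE.
by apply/ffunP => i; rewrite [LHS]fa0 ffunE.
Qed.

Lemma radicalMr a b : a \in J -> a * b \in J.
Proof. by move=> /radicalP aJ; apply/radicalP => i; rewrite char_atM aJ mul0r. Qed.

Lemma radicalMl a b : b \in J -> a * b \in J.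
Proof. by move=> /radicalP bJ; apply/radicalP => i; rewrite char_atM bJ mulr0. Qed.

(* V has a maximal proper right submodule W, and the annihilator of any element
   of the simple module V / W is a maximal right ideal, so V J is in W. *)
Lemma nakayama (V : {vspace A}) :
  (V * fullv <= V)%VS -> V != 0%VS -> ~~ (V <= V * J)%VS.
Proof.
move=> V_right V0.
pose P d := `[< exists W : {vspace A},
  [/\ (W * fullv <= W)%VS, (W <= V)%VS, W != V & \dim W = d] >].
have exP : exists d, P d.
  by exists 0%N; apply/asboolP; exists 0%VS; rewrite prod0v !sub0v dimv0 eq_sym.
have leP d : P d -> (d <= \dim V)%N.
  by move=> /asboolP[W [_ WV _ <-]]; exact: dimvS.
have [d /asboolP[W [W_right WV WneV dW]] d_max] := ex_maxnP exP leP.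
have nVW : ~~ (V <= W)%VS.
  by apply: contra WneV => VW; rewrite eqEsubv WV VW.
have WM w b : w \in W -> w * b \in W.
  by move=> wW; apply: (subvP W_right); rewrite memv_mul ?memvf.
have VM w b : w \in V -> w * b \in V.
  by move=> wW; apply: (subvP V_right); rewrite memv_mul ?memvf.
suff VJW : (V * J <= W)%VS by apply: contra nVW => /subv_trans; exact.
apply/prodvP => v j vV jJ; have [vW|vW] := boolP (v \in W); first exact: WM.
have : @jacobson_radical A j.
  apply/f_ker; apply/ffunP => i; rewrite ffunE; exact: (radicalP _ jJ).
move=> /(_ [set a | v * a \in W]); apply.
have sub_ann : @submodule A^c (A^c)^o [set a | v * a \in W].
  apply/submoduleP; split=> /= [|a u u' uW u'W]; first by rewrite mulr0 mem0v.
  rewrite [a *: u](_ : _ = (u : A) * a) // [X in X \in _]mulrDr.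
  by rewrite memvD // mulrA WM.
split=> //; first exact: submoduleT.
  split=> // /(_ 1 I) /=; by rewrite mulr1 (negPf vW).
move=> K sK annK _; have [KE|KE] := pselect (K = [set a | v * a \in W]);
  first by left.
right; have [b Kb vbW] : exists2 b : A, K b & v * b \notin W.
  apply: contrapT => nex; apply: KE; apply/seteqP; split=> // b Kb /=.
  by apply: contrapT => vbW; apply: nex; exists b => //; exact/negP.
(* This right ideal lies in [V] and is larger than [W], so it is [V]. Hence [v = w + v * b * c] with
   [w] in [W], so [1 - b * c] annihilates [v] modulo [W] and lies in [K]; since [b] is in [K], so is
   1. *)
pose W' := (W + <[v * b]> * fullv)%VS.
have W'V : (W' <= V)%VS.
  rewrite subv_add WV; apply/prodvP => w c /vlineP[x ->] _.
  by rewrite VM // memvZ // VM.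
have W'_right : (W' * fullv <= W')%VS.
  rewrite prodvDl addvS // -prodvA prodvSr //; exact: subvf.
have W'E : W' = V.
  apply/eqP; apply: contraT => W'V'.
  have := d_max (\dim W'); rewrite -dW => /(_ _) le.
  have {}le : (\dim W' <= \dim W)%N by apply: le; apply/asboolP; exists W'.
  have WW' : (W <= W')%VS by exact: addvSl.
  have /eqP WE : W == W' by rewrite -(dimv_leqif_eq WW') eqn_leq le dimvS.
  case/negP: vbW; rewrite WE; apply: (subvP (addvSr _ _)).
  by rewrite -[X in X \in _]mulr1 memv_mul ?memv_line ?memvf.
have : v \in W' by rewrite W'E.
case/memv_addP => w wW [u]; rewrite -[(_ * _)%VS]/(<[v * b]> * _)%VS.
move=> uE vE.
have [c uc] : exists c, u = v * b * c.
  have : (<[v * b]> * fullv <= limg (amull (v * b)%R))%VS.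
    apply/prodvP => ? c /vlineP[x ->] _.
    apply/memv_imgP; exists (x *: c); first exact: memvf.
    by rewrite lfunE /= -scalerAr -scalerAl.
  move=> /subvP/(_ _ uE)/memv_imgP[c _ ->]; by exists c; exact: lfunE.
have Kbc : K (b * c : A) by exact: (@submoduleZ A^c _ K (c : A^c) b sK Kb).
have K1bc : K (1 - b * c : A).
  by apply: annK => /=; rewrite mulrBr mulr1 mulrA -uc [X in X - _]vE addrK.
have K1 : K (1 : A).
  by rewrite -[1](subrK (b * c : A)); exact: (@submoduleD A^c _ K _ _ sK K1bc Kbc).
apply/seteqP; split=> // a _.
have aE : (a : A^c) *: (1 : (A^c)^o) = a by exact: (mul1r (a : A)).
by rewrite -aE; apply: submoduleZ.
Qed.

Lemma radical_expSr i a b : a \in (J ^+ i)%VS -> b \in J -> a * b \in (J ^+ i.+1)%VS.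
Proof. by move=> aJ bJ; rewrite expvSr memv_mul. Qed.

Lemma radical_expS i a b : a \in J -> b \in (J ^+ i)%VS -> a * b \in (J ^+ i.+1)%VS.
Proof. by move=> aJ bJ; rewrite expvSl memv_mul. Qed.

(** By [nakayama] the dimension drops strictly from each nonzero power to the next, so after more
    than dim A steps the power must vanish. *)
Lemma radical_nilpotent : exists m, (J ^+ m = 0)%VS.
Proof.
suff H i : (J ^+ i.+1 = 0)%VS \/ (\dim (J ^+ i.+1) + i <= \dim {:A})%N.
  exists (\dim {:A}).+2; have [//|le] := H (\dim {:A}).+1.
  by move: le; rewrite addnS ltnNge leq_addl.
elim: i => [|i [J0|IHi]]; first by right; rewrite addn0 dimvS ?subvf.
  by left; rewrite expvSr J0 prod0v.
have [J0|Jn0] := eqVneq (J ^+ i.+1)%VS 0%VS; first by left; rewrite expvSr J0 prod0v.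
right; rewrite addnS; apply: leq_trans IHi; rewrite -addSn leq_add2r.
have JR : (J * fullv <= J)%VS by apply/prodvP => a b aJ _; exact: radicalMr.
have sub : (J ^+ i.+2 <= J ^+ i.+1)%VS.
  by rewrite expvSr expvSr -prodvA prodvSr // (subv_trans _ JR) // prodvSr ?subvf.
rewrite ltnNge; apply/negP => le.
have JiR : (J ^+ i.+1 * fullv <= J ^+ i.+1)%VS by rewrite expvSr -prodvA prodvSr.
apply: (negP (nakayama JiR Jn0)).
by rewrite -expvSr -(dimv_leqif_sup sub) eqn_leq le dimvS.
Qed.

End Elementary.

(** Stated for commuting elements of an arbitrary ring because it is applied both in [A], to lift
    idempotents, and in the field [K]. *)
Lemma subX_pchar_comm (R : nzRingType) (p : nat) (x y : R) m :
  p \in [pchar R] -> GRing.comm x y ->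
  (x - y) ^+ (p ^ m) = x ^+ (p ^ m) - y ^+ (p ^ m).
Proof.
move=> pR xy; elim: m => [|m IHm]; first by rewrite !expr1.
rewrite expnSr !exprM IHm.
have /(pFrobenius_autB_comm pR) : GRing.comm (x ^+ (p ^ m)) (y ^+ (p ^ m)).
  by apply: commrX; apply: commr_sym; apply: commrX; apply: commr_sym.
by [].
Qed.

(** * Eigenvectors, extensions and blocks of an elementary algebra *)

Section ElementaryModules.
Variables (k : finFieldType) (A : falgType k) (n : nat).
Variable f : {lrmorphism A -> {ffun 'I_n -> k^o} | *:%R}.
Hypothesis f_surj : forall y, exists x, f x = y.
Hypothesis f_ker : forall x, f x = 0 <-> @jacobson_radical A x.
Implicit Types a b c : A.
Local Notation chi := (char_at f).
Local Notation J := (radical f).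

Lemma opp_scalerA (M : lmodType A^c) a b (m : M) :
  (a : A^c) *: ((b : A^c) *: m) = ((b * a : A) : A^c) *: m.
Proof. exact: scalerA. Qed.

Lemma char_at_opM i (a b : A^c) : chi i (a * b : A^c) = chi i b * chi i a.
Proof. exact: char_atM. Qed.

Lemma char_atX i a m : chi i (a ^+ m) = chi i a ^+ m.
Proof. by elim: m => [|m IHm]; rewrite ?char_at1 // !exprS char_atM IHm. Qed.

(** Modulo [J], such a [g] is the primitive idempotent of the factor of index [i]. *)
Lemma sub_scalar_radical i a g : (forall l, chi l g = (l == i)%:R) ->
  g * a - chi i a *: g \in J /\ a * g - chi i a *: g \in J.
Proof.
move=> gi; split; apply/radicalP => l.
  rewrite char_atD char_atN char_atM char_atZ gi.
  by case: eqP => [->|_]; rewrite ?mul1r ?mulr1 ?mul0r ?mulr0 subrr.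
rewrite char_atD char_atN char_atM char_atZ gi.
by case: eqP => [->|_]; rewrite ?mul1r ?mulr1 ?mul0r ?mulr0 subrr.
Qed.

(** Take the least power of [J] that sends [m] into [N]. Some [c] in the power just below keeps [m]
    outside [N], while [J] sends [c *: m] into [N]; so the product of copies of [k] acts on [c *: m]
    modulo [N], and one of its components [eps i] survives. That component is an eigenvector for
    [chi i] modulo [N]. *)
Lemma eigenvector_mod (M : lmodType A^c) (N : set M) (m : M) :
  submodule N -> ~ N m ->
  exists a0 i, ~ N ((a0 : A^c) *: m) /\
    forall a, N ((a : A^c) *: ((a0 : A^c) *: m)
                 - scalar_op A (chi i a) *: ((a0 : A^c) *: m)).
Proof.
move=> sN Nm; pose P l := `[< forall c, c \in (J ^+ l)%VS -> N ((c : A^c) *: m) >].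
have exP : exists l, P l.
  have [l Jl] := radical_nilpotent f_ker; exists l; apply/asboolP => c.
  by rewrite Jl memv0 => /eqP->; rewrite scale0r; exact: submodule0.
have [[|l] /asboolP Pl l_min] := ex_minnP exP.
  by case: Nm; rewrite -[m](scale1r (m : M)); apply: (Pl (1 : A));
    rewrite expv0 memv_line.
have [c cJ Nc] : exists2 c, c \in (J ^+ l)%VS & ~ N ((c : A^c) *: m).
  apply: contrapT => nex; suff /l_min : P l by rewrite ltnn.
  by apply/asboolP => c cJ; apply: contrapT => Nc; apply: nex; exists c.
have NJ j : j \in J -> N ((j : A^c) *: ((c : A^c) *: m)).
  by move=> jJ; rewrite opp_scalerA; apply: Pl; rewrite radical_expSr.
have [eps epsP] := choice (char_at_lift f_surj).
have [i Ni] : exists i, ~ N ((c * eps i : A^c) *: m).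
  apply: contrapT => nex; apply: Nc.
  have : N ((1 - \sum_i eps i : A^c) *: ((c : A^c) *: m)).
    apply: NJ; apply/radicalP => l'; rewrite char_atD char_atN char_at1.
    rewrite (big_morph (chi l') (char_atD f l') (char_at0 f l')).
    under eq_bigr do rewrite epsP.
    rewrite (bigD1 l') //= eqxx big1 ?addr0 ?subrr // => s.
    by rewrite eq_sym => /negPf->.
  rewrite scalerBl scale1r => Nsub; apply: submodule_subr Nsub _ => //.
  rewrite scaler_suml; elim/big_ind: _ => [||s _]; first exact: submodule0.
    by move=> x y; exact: submoduleD.
  by rewrite opp_scalerA; apply: contrapT => Ns; apply: nex; exists s.
exists (c * eps i), i; split=> // a.
rewrite /scalar_op !opp_scalerA -scalerBl.
rewrite [X in X *: m](_ : _ = c * (eps i * a - chi i a *: eps i) :> A).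
  by apply: Pl; rewrite radical_expSr //; have [] := sub_scalar_radical a (epsP i).
by rewrite mulrBr mulrA mulr_algr -scalerAr.
Qed.

Section Extension.
Variables (i l : 'I_n) (D : A -> k).
Hypothesis D_additive : forall a b, D (a + b) = D a + D b.
Hypothesis D_mul : forall a b, D (a * b) = chi i a * D b + D a * chi l b.

(** The index is a phantom argument that keeps the simple modules of different characters apart, all
    of them having carrier [k]. *)
Definition line_module of 'I_n : Type := k.

HB.instance Definition _ s := GRing.Zmodule.on (line_module s).

Definition line_scale s (a : A^c) (x : line_module s) : line_module s := chi s a * x.

Fact line_scaleA s (a b : A^c) x : @line_scale s a (line_scale b x) = line_scale
  (a * b) x.
Proof.
by rewrite /line_scale char_at_opM mulrA [chi s a * _]mulrC.
Qed.

Fact line_scale1 s : left_id 1 (@line_scale s).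
Proof. by move=> x; rewrite /line_scale char_at1 mul1r. Qed.

Fact line_scaleDr s : right_distributive (@line_scale s) +%R.
Proof. by move=> a x y; rewrite /line_scale mulrDr. Qed.

Fact line_scaleDl s x (a b : A^c) :
  @line_scale s (a + b) x = line_scale a x + line_scale b x.
Proof. by rewrite /line_scale [chi s _]char_atD mulrDl. Qed.

HB.instance Definition _ s := GRing.Zmodule_isLmodule.Build A^c (line_module s)
  (@line_scaleA s) (@line_scale1 s) (@line_scaleDr s) (@line_scaleDl s).

Definition plane_module : Type := (k * k)%type.

HB.instance Definition _ := GRing.Zmodule.on plane_module.

(** The action by triangular matrices with diagonal entries [chi i a], [chi l a] and corner [D a].
    Compatibility with products is exactly the rule [D_mul]. *)
Definition plane_scale (a : A^c) (v : plane_module) : plane_module :=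
  (chi i a * v.1, D a * v.1 + chi l a * v.2).

Fact plane_scaleA (a b : A^c) v : plane_scale a (plane_scale b v) = plane_scale
  (a * b) v.
Proof.
rewrite /plane_scale /= !char_at_opM [D (a * b)](D_mul b a).
by congr pair; ring.
Qed.

Fact plane_scale1 : left_id 1 plane_scale.
Proof.
move=> [x y]; rewrite /plane_scale !char_at1 !mul1r /=.
have : D (1 * 1) = D 1 + D 1 by rewrite D_mul !char_at1 mul1r mulr1.
rewrite mulr1 => /eqP; rewrite addrC -subr_eq subrr eq_sym => /eqP->.
by rewrite mul0r add0r.
Qed.

Fact plane_scaleDr : right_distributive plane_scale +%R.
Proof. by move=> a x y; rewrite /plane_scale /=; congr pair => /=; ring. Qed.

Fact plane_scaleDl v (a b : A^c) :
  plane_scale (a + b) v = plane_scale a v + plane_scale b v.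
Proof.
rewrite /plane_scale ![char_at _ _ (a + b)]char_atD [D _]D_additive.
by congr pair => /=; ring.
Qed.

HB.instance Definition _ := GRing.Zmodule_isLmodule.Build A^c plane_module
  plane_scaleA plane_scale1 plane_scaleDr plane_scaleDl.

Fact plane_inj_linear : linear ((fun t => (0, t)) : line_module l -> plane_module).
Proof.
move=> a u v; apply: (congr2 pair).
  by rewrite /= mulr0 addr0.
by rewrite /= mulr0 add0r.
Qed.

Fact plane_proj_linear : linear (fst : plane_module -> line_module i).
Proof. by []. Qed.

Fact plane_inj_injective : injective (linear_map plane_inj_linear).
Proof. by move=> t u []. Qed.

Fact plane_proj_surjective s : exists e, linear_map plane_proj_linear e = s.
Proof. by exists (s, 0). Qed.

Fact plane_exact e :
  linear_map plane_proj_linear e = 0 <-> exists t, linear_map plane_inj_linear t = e.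
Proof. by split=> [|[t <-]//]; case: e => s t /= ->; exists t. Qed.

Definition plane_extension : extension (line_module i) (line_module l) :=
  Extension plane_inj_injective plane_proj_surjective plane_exact.

Lemma simple_line_module s : simple_module (line_module s).
Proof.
split=> [|N sN]; first by exists 1; apply/eqP; exact: oner_neq0.
have [[x [Nx x0]]|nex] := pselect (exists x, N x /\ x <> 0).
  right; apply/seteqP; split=> // y _.
  have -> : y = scalar_op A ((y : k) / (x : k)) *: x.
    change (y = chi s ((y : k) / (x : k))%:A * (x : k)).
    by rewrite char_at_alg divfK //; apply/eqP.
  exact: submoduleZ.
left; apply/seteqP; split=> [x Nx|_ ->]; last exact: submodule0.
by apply: contrapT => x0; apply: nex; exists x.
Qed.

Hypothesis hQ : right_quiver_totally_disconnected A.
Hypothesis i_neq_l : i != l.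

(** The plane is an extension of two nonisomorphic lines, so it splits. An element of [J] acts as 0
    on the split extension, but sends the vector (1, 0) of the plane to (0, D a). *)
Lemma skew_derivation_eq0 a : a \in J -> D a = 0.
Proof.
have no_iso : ~ isomorphic_modules (line_module i) (line_module l).
  move=> [g g_bij]; have [c ci] := char_at_lift f_surj i.
  pose u : line_module i := (1 : k).
  have cu : (c : A^c) *: u = u by change (chi i c * (1 : k) = 1);
    rewrite ci eqxx mulr1.
  have : (c : A^c) *: g u = 0.
    by change (chi l c * (g u : k) = 0); rewrite ci eq_sym (negPf i_neq_l) mul0r.
  rewrite -linearZ cu => /eqP.
  by rewrite -(raddf0 g) (inj_eq (bij_inj g_bij)); apply/negP; exact: oner_neq0.
have [h [hinj hproj]] : extension_equiv plane_extension
    (split_extension (line_module i) (line_module l)).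
  apply: contrapT => nsplit; apply: no_iso; apply: hQ.
  by split; [exact: simple_line_module | exact: simple_line_module | exists
    plane_extension].
move=> /radicalP aJ.
pose v : plane_module := (1, 0).
have av : (a : A^c) *: v = (0, D a).
  by apply: (congr2 pair); rewrite /= ?aJ ?mul0r ?mulr0 ?mulr1 ?addr0.
have : h ((a : A^c) *: v) = (a : A^c) *: h v by rewrite linearZ.
rewrite av; have /= -> := congr1 (@^~ (D a)) hinj.
move=> /(congr1 fst) /= ->; change (chi l a * ((h v).1 : k) = 0).
by rewrite aJ mul0r.
Qed.

End Extension.

Section Blocks.
Hypothesis hQ : right_quiver_totally_disconnected A.

(* Otherwise a |-> lambda (g a h), for a linear form lambda that kills J ^+ 2 but
   not g j h, is a skew derivation;
     it defines a nonsplit extension of simple modules. *)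
Lemma radical_block_square i l g h : i != l ->
  (forall s, chi s g = (s == i)%:R) -> (forall s, chi s h = (s == l)%:R) ->
  g * h = 0 -> forall j, j \in J -> g * j * h \in (J ^+ 2)%VS.
Proof.
move=> il gi hl gh0 j jJ; apply: contraT => gjh.
pose pr a := a - projv (J ^+ 2)%VS a.
have prD a b : pr (a + b) = pr a + pr b by rewrite /pr linearD /= opprD addrACA.
have prZ (x : k) a : pr (x *: a) = x *: pr a by rewrite /pr linearZ scalerBr.
have [s prs] : exists s, coord (vbasis fullv) s (pr (g * j * h)) != 0.
  apply/existsP; apply: contraT; rewrite negb_exists => /forallP pr0.
  case/negP: gjh; suff : pr (g * j * h) = 0.
    by move/eqP; rewrite subr_eq0 => /eqP->; exact: memv_proj.
  rewrite (coord_vbasis (memvf (pr _))) big1 // => s _.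
  by move: (pr0 s); rewrite negbK => /eqP->; rewrite scale0r.
pose D a := coord (vbasis fullv) s (pr (g * a * h)).
suff : D j = 0 by move/eqP: prs.
apply: (skew_derivation_eq0 (i := i) (l := l)) => //.
  by move=> a b; rewrite /D mulrDr mulrDl prD linearD.
move=> a b; rewrite /D.
(* Both [g * a] and [b * h] are a scalar multiple of [g], respectively [h], plus an element of [J].
   The product of the two scalar parts vanishes since [g * h = 0], and the product of the two
   radical parts lies in [J ^+ 2], which [pr] kills. *)
have -> : g * (a * b) * h = chi i a *: (g * b * h) + chi l b *: (g * a * h)
    + (g * a - chi i a *: g) * (b * h - chi l b *: h).
  rewrite mulrBl !mulrBr -!scalerAl -!scalerAr gh0 !scaler0 subr0 !mulrA.
  by rewrite addrC addrA subrK subrK.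
have prJ : pr ((g * a - chi i a *: g) * (b * h - chi l b *: h)) = 0.
  rewrite /pr projv_id ?subrr // expv2 memv_mul //.
    by have [] := sub_scalar_radical a gi.
  by have [] := sub_scalar_radical b hl.
by rewrite !prD !prZ prJ addr0 linearD !linearZ /= [_ * chi l b]mulrC.
Qed.

Lemma idempotent_lift i :
  exists e, e * e = e /\ forall l, chi l e = (l == i)%:R.
Proof.
have [a ai] := char_at_lift f_surj i; have [m Jm] := radical_nilpotent f_ker.
have [p p_pr pk] := finPcharP k; have pA : p \in [pchar A] by rewrite pchar_lalg.
(* e ^+ 2 - e = (a ^+ 2 - a) ^+ (p ^ m), and a ^+ 2 - a is nilpotent. *)
exists (a ^+ (p ^ m)); split; last first.
  move=> l; rewrite char_atX ai; case: eqP => _; first by rewrite expr1n.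
  by rewrite expr0n expn_eq0 eqn0Ngt (prime_gt0 p_pr).
apply/eqP; rewrite -subr_eq0 -exprMn_comm // -subX_pchar_comm //; last first.
  exact/commr_sym/commrM.
have xJ s : (a * a - a) ^+ s \in (J ^+ s)%VS.
  elim: s => [|s IHs]; first by rewrite expr0 expv0 memv_line.
  rewrite exprSr radical_expSr //; apply/radicalP => l.
  by rewrite char_atD char_atN char_atM ai; case: eqP => _;
    rewrite ?mulr1 ?mulr0 subrr.
have /eqP xm : (a * a - a) ^+ m == 0 by have := xJ m; rewrite Jm memv0.
have mp : (m <= p ^ m)%N by apply/ltnW/ltn_expl/prime_gt1.
by rewrite -(subnK mp) exprD xm mulr0.
Qed.

(** The inclusion of g J h in [J ^+ 2] improves itself. Inserting [1 = g + h] between two factors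
    [a], [b] of [J] turns [g * (a * b) * h] into [(g * a) * (g * b * h) + (g * a * h) * (b * h)],
    where each term contains an element of g J h; so every power reached yields the next, and [J] is
    nilpotent. *)
Lemma radical_block_eq0 g h : g * g = g -> h * h = h -> g * h = 0 -> h * g = 0 ->
  g + h = 1 -> (forall j, j \in J -> g * j * h \in (J ^+ 2)%VS) ->
  forall j, j \in J -> g * j * h = 0.
Proof.
move=> gg hh gh hg gh1 gJh; have [m Jm] := radical_nilpotent f_ker.
suff H s j : j \in J -> g * j * h \in (J ^+ s.+1)%VS.
  by move=> j /(H m); rewrite expvSr Jm prod0v memv0 => /eqP.
elim: s j => [|s IHs] j jJ.
  by rewrite expv1 radicalMr // radicalMl.
have gjh2 := gJh j jJ; rewrite -gg -hh -[_ * _ * (h * h)]mulrA.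
have -> : g * g * (j * (h * h)) = g * (g * j * h) * h by rewrite !mulrA.
suff : (J ^+ 2 <= (linfun (g \*o (h \o* idfun)) @^-1: (J ^+ s.+2)))%VS.
  move=> /subvP/(_ _ gjh2); by rewrite -memv_preim lfunE /= !mulrA.
rewrite expv2; apply/prodvP => a b aJ bJ; rewrite -memv_preim lfunE /=.
have -> : g * (a * b * h) = (g * a) * (g * b * h) + (g * a * h) * (b * h).
  by rewrite -[a in LHS]mulr1 -gh1 mulrDr !mulrDl mulrDr !mulrA.
rewrite memvD //.
  by apply: radical_expS; [exact: radicalMl | exact: IHs].
by apply: radical_expSr; [exact: IHs | exact: radicalMr].
Qed.

(** With [e' = 1 - e], centrality of [e] means that e A e' and e' A e vanish. Both lie in [J], so by
    [radical_block_eq0] it is enough to place e J e' and e' J e in [J ^+ 2]; decomposing 1 as the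
    sum of the [eps s] plus a radical element reduces this to pairs of distinct characters. *)
Lemma central_idempotent_lift i : exists e,
  [/\ e * e = e, forall l, chi l e = (l == i)%:R & forall a, e * a = a * e].
Proof.
have [e [ee ei]] := idempotent_lift i; exists e; split=> // a.
pose e' := 1 - e.
have ee' : e * e' = 0 by rewrite /e' mulrBr mulr1 ee subrr.
have e'e : e' * e = 0 by rewrite /e' mulrBl mul1r ee subrr.
have e'e' : e' * e' = e' by rewrite {1}/e' mulrBl mul1r ee' subr0.
have e1 : e + e' = 1 by rewrite /e' addrC subrK.
have e'i l : chi l e' = (l != i)%:R.
  by rewrite char_atD char_atN char_at1 ei; case: eqP; rewrite ?subrr ?subr0.
have [eps epsP] := choice (char_at_lift f_surj).
have J1 j : j \in J -> exists2 j', j' \in J & 1 = \sum_s eps s + j'.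
  move=> _; exists (1 - \sum_s eps s); last by rewrite addrC subrK.
  apply/radicalP => l; rewrite char_atD char_atN char_at1.
  rewrite (big_morph (chi l) (char_atD f l) (char_at0 f l)).
  under eq_bigr do rewrite epsP.
  rewrite (bigD1 l) //= eqxx big1 ?addr0 ?subrr // => s.
  by rewrite eq_sym => /negPf->.
have eJe' j : j \in J -> e * j * e' \in (J ^+ 2)%VS.
  move=> jJ; have [j' j'J E] := J1 j jJ.
  rewrite -[_ * e']mulr1 E mulrDr mulr_sumr memvD //; last first.
    rewrite expv2 memv_mul // radicalMr // radicalMl //.
  (* For [s = i] every character kills [e' * eps s], which is therefore in [J]. For other [s] it is
     a lift of the component [s] orthogonal to [e], as [radical_block_square] requires. *)
  apply: memv_suml => s _; rewrite -mulrA; have [->|si] := eqVneq s i.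
    rewrite expv2 memv_mul //; first exact: radicalMl.
    apply/radicalP => l.
    by rewrite char_atM e'i epsP; case: eqP; rewrite ?mul0r ?mulr0.
  apply: (@radical_block_square i s e (e' * eps s)) => //; first by rewrite eq_sym.
    move=> l; rewrite char_atM e'i epsP; have [->|] := eqVneq l s; rewrite ?mulr0 //.
    by rewrite si mul1r.
  by rewrite mulrA ee' mul0r.
have e'Je j : j \in J -> e' * j * e \in (J ^+ 2)%VS.
  move=> jJ; have [j' j'J E] := J1 j jJ.
  rewrite -!mulrA -[X in X \in _]mul1r E mulrDl mulr_suml memvD //; last first.
    rewrite expv2 memv_mul // radicalMl // radicalMr //.
  apply: memv_suml => s _; rewrite !mulrA; have [->|si] := eqVneq s i.
    rewrite -mulrA expv2 memv_mul //; last exact: radicalMr.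
    apply/radicalP => l.
    by rewrite char_atM e'i epsP; case: eqP; rewrite ?mul0r ?mulr0.
  apply: (@radical_block_square s i (eps s * e') e) => //.
    move=> l; rewrite char_atM e'i epsP; have [->|] := eqVneq l s; rewrite ?mul0r //.
    by rewrite si mul1r.
  by rewrite -mulrA e'e mulr0.
have eae' b : e * b * e' = 0.
  have -> : e * b * e' = e * (e * b * e') * e' by rewrite !mulrA ee -[RHS]mulrA e'e'.
  apply: radical_block_eq0 => //; apply/radicalP => l.
  by rewrite !char_atM ei e'i; case: eqP; rewrite ?mul0r ?mulr0.
have e'ae b : e' * b * e = 0.
  have -> : e' * b * e = e' * (e' * b * e) * e by rewrite !mulrA e'e' -[RHS]mulrA ee.
  apply: radical_block_eq0 => //; first by rewrite addrC.
  apply/radicalP => l.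
  by rewrite !char_atM ei e'i; case: eqP; rewrite ?mul0r ?mulr0.
by rewrite -[e * a]mulr1 -[a * e]mul1r -e1 mulrDr mulrDl eae' addr0 !mulrA e'ae addr0.
Qed.

End Blocks.
End ElementaryModules.

(** The last hypothesis makes the sum of [N] and of the [F]-line of [m] stable under [S]; by
    maximality this sum is [N']. *)
Lemma maximal_submodule_line (F : fieldType) (S : nzRingType) (j : {rmorphism F -> S})
    (M : lmodType S) (N N' : set M) (m : M) :
  maximal_submodule N N' -> N' m -> ~ N m ->
  (forall r c, exists c', N (r *: (j c *: m) - j c' *: m)) ->
  forall v, N' v <-> exists c, N (v - j c *: m).
Proof.
move=> [sN sN' NN' maxN] N'm Nm rm.
pose K := [set v | exists c, N (v - j c *: m)].
have sK : submodule K.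
  apply/submoduleP; split.
    by exists 0; rewrite rmorph0 scale0r subr0; exact: submodule0.
  move=> r u v [c Nu] [d Nv]; have [c' Nr] := rm r c.
  exists (c' + d); rewrite rmorphD scalerDl opprD addrACA.
  apply: submoduleD => //; rewrite -[r *: u](subrK (r *: (j c *: m))) -addrA.
  by apply: submoduleD => //; rewrite -scalerBr; exact: submoduleZ.
have NK : N `<=` K.
  by move=> v Nv; exists 0; rewrite rmorph0 scale0r subr0.
have KN' : K `<=` N'.
  move=> v [c Nv]; apply: (submodule_subr sN' (NN'.1 _ Nv)); exact: submoduleZ.
have [KE|KE] := maxN K sK NK KN'.
  by case: Nm; rewrite -KE; exists 1; rewrite rmorph1 scale1r subrr;
    exact: submodule0.
by move=> v; rewrite -KE.
Qed.

(** * Converse of Schur's Lemma for the elementary algebra *)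

Section ElementaryCSL.
Variables (k : finFieldType) (A : falgType k) (n : nat).
Variable f : {lrmorphism A -> {ffun 'I_n -> k^o} | *:%R}.
Hypothesis f_surj : forall y, exists x, f x = y.
Hypothesis f_ker : forall x, f x = 0 <-> @jacobson_radical A x.
Implicit Types a b : A.
Local Notation chi := (char_at f).
Local Notation J := (radical f).
Local Notation sc := (@scalar_op k A).

(** Each step of a composition series contains an eigenvector modulo the previous term, hence adds
    exactly one line over [k]. *)
Lemma elementary_finite_length_basis (M : lmodType A^c) : finite_length M ->
  exists d (w : 'I_d -> M), spans sc w setT /\ free_family sc w.
Proof.
move=> [l [F [F0 Fl Fmax]]]; rewrite -Fl.
suff H i : (i <= l)%N -> exists d (w : 'I_d -> M), spans sc w (F i) /\
  free_family sc w.
  exact: H.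
elim: i => [|i IHi] il.
  exists 0%N, (fun=> 0); split=> [v|c _ [//]].
  rewrite F0; split=> [->|[c ->]]; last by rewrite /comb big_ord0.
  by exists (fun=> 0); rewrite /comb big_ord0.
have [d [w [wF w_free]]] := IHi (ltnW il).
have maxF := Fmax i il; have [sN sN' NN' _] := maxF.
have [m N'm Nm] : exists2 m, F i.+1 m & ~ F i m.
  by move: NN' => [_ /nonsubset[v [? ?]]]; exists v.
have [a0 [s [Nm' m'E]]] := eigenvector_mod f_surj f_ker sN Nm.
exists d.+1, (cons_family ((a0 : A^c) *: m) w); split;
  last exact: free_cons wF w_free Nm'.
apply: spans_cons wF _; apply: maximal_submodule_line maxF _ Nm' _;
  first exact: submoduleZ.
move=> r c; exists (c * chi s r); rewrite rmorphM -scalerA scalerA -scalar_op_central.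
by rewrite -scalerA -scalerBr; exact: submoduleZ.
Qed.

Hypothesis hQ : right_quiver_totally_disconnected A.

Lemma division_endo_inj (R : nzRingType) (M : lmodType R) (g : M -> M) :
  division_endomorphism_ring M -> linear g -> (exists m, g m <> 0) -> injective g.
Proof.
move=> [_ Mdiv] g_lin [m gm]; have [] := Mdiv (linear_map g_lin).
  by move=> /(congr1 (@^~ m)).
by move=> h [hg _] x y gxy; have /= := congr1 (@^~ x) hg;
  rewrite gxy => <-; have /= := congr1 (@^~ y) hg.
Qed.

(** Every endomorphism used here is nonzero, hence injective. The central idempotent of the
    character of [s] fixes [s]; being injective and idempotent, it acts on [M] as the identity, so
    all of [A] acts through [chi i] up to [J]. Once [J] is shown to kill [M], any [k]-linear map is
    an endomorphism, in particular a projection onto the line of [s], whose injectivity leaves only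
    that line. *)
Lemma elementary_CSL_line (M : lmodType A^c) : division_endomorphism_ring M ->
  exists (s : M) i, [/\ s <> 0, (forall a, (a : A^c) *: s = sc (chi i a) *: s) &
    forall m, exists c, m = sc c *: s].
Proof.
move=> Mdiv; have [m0 m0n] : exists m : M, m <> 0.
  apply: contrapT => M0; case: Mdiv => + _; apply; apply/funext => m /=.
  by apply: contrapT => m0; apply: M0; exists m.
have [a0 [i [sn /= sE]]] := eigenvector_mod f_surj f_ker (@submodule_set0 _ M) m0n.
set s := (a0 : A^c) *: m0 in sn sE.
have {}sE a : (a : A^c) *: s = sc (chi i a) *: s.
  by apply/eqP; rewrite -subr_eq0 sE.
clearbody s; exists s, i; split=> //.
have [e [ee ei eC]] := central_idempotent_lift f_surj f_ker hQ i.
have e_lin : linear (fun m : M => (e : A^c) *: m).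
  by move=> a u v; rewrite scalerDr !opp_scalerA eC.
have es : (e : A^c) *: s = s by rewrite sE ei eqxx rmorph1 scale1r.
have e_inj : injective (fun m : M => (e : A^c) *: m).
  by apply: division_endo_inj Mdiv e_lin _; exists s; rewrite es.
have em (m : M) : (e : A^c) *: m = m by apply: e_inj; rewrite opp_scalerA ee.
have am a (m : M) : exists2 j, j \in J & (a : A^c) *: m = sc (chi i a) *: m + (j
  : A^c) *: m.
  exists (e * a - chi i a *: e); first by have [] := sub_scalar_radical a ei.
  rewrite -[in LHS](em m) opp_scalerA -[in X in _ = X + _](em m) opp_scalerA.
  rewrite mulr_algr -scalerDl; congr (_ *: m).
  by change (e * a = chi i a *: e + (e * a - chi i a *: e)); rewrite addrC subrK.
(* An element c of the last power of J that does not kill M acts linearly on M,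
   since a m c and m c a both equal chi i a times m c; but it is nilpotent. *)
have JM j (m : M) : j \in J -> (j : A^c) *: m = 0.
  pose P l := `[< forall c, c \in (J ^+ l)%VS -> forall m : M, (c : A^c) *: m = 0 >].
  have exP : exists l, P l.
    have [l Jl] := radical_nilpotent f_ker; exists l; apply/asboolP => c.
    by rewrite Jl memv0 => /eqP-> m'; rewrite scale0r.
  have [[|[|l]] /asboolP Pl l_min] := ex_minnP exP.
  - by case: sn; rewrite -[s](scale1r (s : M)); apply: (Pl (1 : A));
    rewrite expv0 memv_line.
  - by move=> jJ; apply: Pl; rewrite expv1.
  move=> _; exfalso.
  have [c cJ [m1 cm1]] : exists2 c, c \in (J ^+ l.+1)%VS & exists m : M, (c :
    A^c) *: m <> 0.
    apply: contrapT => nex; suff /l_min : P l.+1 by rewrite ltnn.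
    apply/asboolP => c cJ m'; apply: contrapT => cm'; apply: nex.
    by exists c => //; exists m'.
  have cJ1 : c \in J.
    suff /subvP : (J ^+ l.+1 <= J)%VS by apply.
    by rewrite expvSr; apply/prodvP => x y _; exact: radicalMl.
  have c_lin : linear (fun m : M => (c : A^c) *: m).
    move=> a u v; rewrite scalerDr; congr (_ + _).
    have [j1 j1J ->] := am a u; have [j2 j2J ->] := am a ((c : A^c) *: u).
    rewrite scalerDr !opp_scalerA.
    rewrite (Pl (j1 * c)) ?radical_expS // (Pl (c * j2)) ?radical_expSr // !addr0.
    by rewrite mulr_algr mulr_algl.
  apply: (cm1); apply: (division_endo_inj Mdiv c_lin); first by exists m1.
  by rewrite scaler0 opp_scalerA Pl // radical_expSr.
have {}am a (m : M) : (a : A^c) *: m = sc (chi i a) *: m.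
  by have [j jJ ->] := am a m; rewrite JM // addr0.
(* A hyperplane H avoiding s gives the projection of M onto the line of s. *)
pose P (X : set M) := [/\ ~ X s, forall u v, X u -> X v -> X (u + v) &
  forall c u, X u -> X (sc c *: u)].
have [H [[Hs HD HZ] Hmax]] : exists H, P H /\ forall B, H `<` B -> ~ P B.
  apply: Zorn_bigcup => C CP C_tot; split.
  - by move=> [X CX Xs]; have [] := CP X CX.
  - move=> u v [X CX Xu] [Y CY Yv].
    have [XY|YX] := C_tot X Y CX CY.
      by exists Y => //; have [_ YD _] := CP Y CY; apply: YD => //; exact: XY.
    by exists X => //; have [_ XD _] := CP X CX; apply: XD => //; exact: YX.
  by move=> c u [X CX Xu]; exists X => //; have [_ _ XZ] := CP X CX; exact: XZ.
have HN u : H u -> H (- u).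
  by move=> /(HZ (-1)); rewrite rmorphN1 scaleN1r.
(* [P] does not ask that 0 belong to [X], because the union of the empty chain is empty; maximality
   of [H] provides it. *)
have H0 : H 0.
  apply: contrapT => H0; apply: (Hmax (H `|` [set 0])).
    by split=> [u Hu|HH]; [left | apply: H0; apply: HH; right].
  split=> [[//|/= s0]|u v|c u].
  - exact: sn.
  - by move=> [Hu|->] [Hv|->]; rewrite ?addr0 ?add0r; [left;
    exact: HD|left|left|right].
  by move=> [Hu|->]; [left; exact: HZ|right; rewrite scaler0].
have Hc (m : M) : exists c, H (m - sc c *: s).
  have [Hm|Hm] := pselect (H m); first by exists 0; rewrite rmorph0 scale0r subr0.
  pose B := [set u | exists2 h, H h & exists c, u = h + sc c *: m].
  have HB : H `<` B.
    split=> [u Hu|HB]; first by exists u => //; exists 0;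
      rewrite rmorph0 scale0r addr0.
    apply: Hm; apply: HB; exists 0 => //; exists 1.
    by rewrite rmorph1 scale1r add0r.
  have [h Hh [c sE']] : B s.
    apply: contrapT => Bs; apply: (Hmax B HB); split=> //.
      move=> _ _ [h1 Hh1 [c1 ->]] [h2 Hh2 [c2 ->]]; exists (h1 + h2); first exact: HD.
      by exists (c1 + c2); rewrite rmorphD scalerDl addrACA.
    move=> c _ [h1 Hh1 [c1 ->]]; exists (sc c *: h1); first exact: HZ.
    by exists (c * c1); rewrite scalerDr rmorphM scalerA.
  have [c0|c0] := eqVneq c 0.
    by case: Hs; rewrite sE' c0 rmorph0 scale0r addr0.
  exists c^-1; rewrite sE' scalerDr scalerA -rmorphM mulVf // rmorph1 scale1r.
  by rewrite opprD addrCA subrr addr0 -scaleNr -rmorphN; exact: HZ.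
have Huniq m c c' : H (m - sc c *: s) -> H (m - sc c' *: s) -> c = c'.
  move=> Hc1 Hc2; apply: contrapT => /eqP cc'.
  have {Hc1 Hc2} : H (sc (c - c') *: s).
    rewrite rmorphB scalerBl -[X in H X]opprB.
    have -> : sc c' *: s - sc c *: s = (m - sc c *: s) - (m - sc c' *: s).
      by rewrite opprB [RHS]addrC [RHS]addrA subrK.
    by apply: (HN); apply: HD => //; exact: HN.
  move=> /(HZ (c - c')^-1); rewrite scalerA -rmorphM mulVf ?subr_eq0 //.
  by rewrite rmorph1 scale1r.
have [la laP] := choice Hc.
have la_lin : linear (fun m => sc (la m) *: s).
  move=> a u v; rewrite [a *: (_ *: s)]am scalerA -rmorphM -scalerDl -rmorphD;
    congr (sc _ *: s).
  apply: (Huniq (a *: u + v)) => //.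
  rewrite [a *: u]am rmorphD rmorphM scalerDl -scalerA opprD addrACA -scalerBr.
  by apply: HD => //; exact: HZ.
have la_inj : injective (fun m => sc (la m) *: s).
  apply: division_endo_inj Mdiv la_lin _; exists s.
  rewrite (_ : la s = 1) ?rmorph1 ?scale1r //.
  by apply: (Huniq s) => //; rewrite rmorph1 scale1r subrr.
(* The projection takes the same value at [m] and at [sc (la m) *: s]. *)
move=> m; exists (la m); apply: la_inj; congr (sc _ *: s).
apply: (Huniq m) => //.
have := HD _ _ (laP m) (laP (sc (la m) *: s)).
by rewrite addrA subrK.
Qed.

Lemma line_simple (F : fieldType) (S : nzRingType) (j : {rmorphism F -> S})
    (M : lmodType S) (s : M) :
  s <> 0 -> (forall m, exists c, m = j c *: s) -> simple_module M.
Proof.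
move=> sn s_span; split=> [|N sN]; first by exists s.
have [[x [Nx x0]]|nex] := pselect (exists x, N x /\ x <> 0).
  right; apply/seteqP; split=> // y _.
  have [c xE] := s_span x; have [d ->] := s_span y.
  have c0 : c != 0.
    by apply: contra_notN x0 => /eqP c0; rewrite xE c0 rmorph0 scale0r.
  apply: submoduleZ => //; rewrite -[s]scale1r -(rmorph1 j) -(mulVf c0) rmorphM
    -scalerA -xE.
  exact: submoduleZ.
left; apply/seteqP; split=> [x Nx|_ ->]; last exact: submodule0.
by apply: contrapT => x0; apply: nex; exists x.
Qed.

Lemma elementary_CSL : has_CSL (@all_modules A^c).
Proof.
move=> M _ /elementary_CSL_line[s [i [sn _ s_span]]].
exact: line_simple sn s_span.
Qed.

End ElementaryCSL.

(** * The Frobenius map of the algebraic closure *)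

Section FrobeniusClosure.
Variable k : finFieldType.

(* To be instantiated by the algebraic closure of k and x |-> x ^+ #|k|. *)
Record frobenius_field := FrobeniusField {
  ff_field : fieldType;
  ff_inj : {rmorphism k -> ff_field};
  ff_frob : {rmorphism ff_field -> ff_field};
  ff_frob_inv : ff_field -> ff_field;
  ff_frobK : cancel ff_frob ff_frob_inv;
  ff_frobKV : cancel ff_frob_inv ff_frob;
  ff_frob_inj : forall c, ff_frob (ff_inj c) = ff_inj c;
  ff_fixed : forall z, ff_frob z = z -> exists c, z = ff_inj c;
  ff_artin_schreier : forall c, exists z, ff_frob z - z = c;
  ff_root : forall p : {poly ff_field}, p`_0 != 0 -> (1 < size p)%N ->
    exists2 z, z != 0 & \sum_(i < size p) p`_i * iter i ff_frob z = 0 }.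

Lemma frobenius_closure : inhabited frobenius_field.
Proof.
have [K [iota _]] := countable_algebraic_closure k.
pose q := #|k|; have q_gt1 : (1 < q)%N := card_finNzRing_gt1 k.
have [p p_pr pk] := finPcharP k.
have pK : p \in [pchar K] by rewrite (fmorph_pchar iota).
have [e qE] : exists e, q = (p ^ e)%N.
  by eexists; exact: card_pprimeChar pk.
pose s (x : K) := x ^+ q.
have sB : zmod_morphism s.
  by move=> x y; rewrite /s qE subX_pchar_comm //; exact: mulrC.
have sM : monoid_morphism s.
  by split=> [|x y]; rewrite /s ?expr1n // exprMn.
pose sigma : {rmorphism K -> K} := HB.pack s
  (GRing.isZmodMorphism.Build K K s sB) (GRing.isMonoidMorphism.Build K K s sM).
have root_ex (P : {poly K}) : size P != 1%N -> exists x, root P x.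
  by move=> /closed_rootP.
have qn x : exists y, sigma y == x.
  have : size ('X^q - x%:P) != 1%N.
    by rewrite size_XnsubC ?(ltnW q_gt1) // eqSS -lt0n (ltnW q_gt1).
  by move=> /root_ex[y]; rewrite rootE !hornerE subr_eq0; exists y.
pose sinv x := xchoose (qn x).
have sinvK : cancel sinv sigma by move=> x; apply/eqP/(xchooseP (qn x)).
have sK : cancel sigma sinv by move=> x; apply: (fmorph_inj sigma); rewrite sinvK.
have iterE i z : iter i sigma z = z ^+ (q ^ i).
  elim: i => [|i IHi]; first by rewrite expr1.
  by rewrite iterS IHi -[sigma _]/(_ ^+ q) -exprM expnSr.
have frob_inj c : sigma (iota c) = iota c.
  by rewrite -[LHS]/(_ ^+ q) -rmorphXn /q expf_card.
have fixed z : sigma z = z -> exists c, z = iota c.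
  (* Over [k] the polynomial X^q - X is the product of all X - c, so each of its roots in [K] is the
     image of some [c]. *)
  move=> sz; have := congr1 (map_poly iota) (finField_genPoly k).
  rewrite rmorphB /= map_polyXn map_polyX rmorph_prod => /(congr1 (horner^~ z)).
  rewrite !hornerE -[z ^+ _]/(sigma z) sz subrr horner_prod => /esym/eqP.
  rewrite prodf_seq_eq0 => /hasP[c _]; rewrite /= rmorphB /= map_polyX map_polyC.
  by rewrite !hornerE subr_eq0 => /eqP; exists c.
have AS c : exists z, sigma z - z = c.
  have : size ('X^q - ('X + c%:P)) != 1%N.
    by rewrite size_polyDl ?size_polyN ?size_XaddC ?size_polyXn // eqSS -lt0n
      (ltnW q_gt1).
  move=> /root_ex[z]; rewrite rootE !hornerE opprD addrA subr_eq0 => /eqP; exists z.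
  by [].
have roots (P : {poly K}) : P`_0 != 0 -> (1 < size P)%N ->
    exists2 z, z != 0 & \sum_(i < size P) P`_i * iter i sigma z = 0.
  (* [Q] is the sum of the P_i X^(q^i) divided by X. Its constant term is the nonzero P_0, so its
     roots are nonzero, and its coefficient of index q^(d+1) - 1 is the leading coefficient of [P],
     so it is not constant. *)
  move=> P0 P1; pose Q := \sum_(i < size P) P`_i *: 'X^((q ^ i).-1) : {poly K}.
  have Q1 : size Q != 1%N.
    apply/eqP => sQ; have [d dP] : exists d, size P = d.+2.
      by case: (size P) P1 => [|[|d]] // _; exists d.
    have : Q`_(q ^ d.+1).-1 = lead_coef P.
      rewrite /Q coef_sum dP big_ord_recr /= coefZ coefXn eqxx mulr1 big1 ?add0r.
        by rewrite lead_coefE dP.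
      move=> i _; rewrite coefZ coefXn; case: eqP => [E|_]; last by rewrite mulr0.
      have := congr1 S E; rewrite !prednK ?expn_gt0 ?(ltnW q_gt1) // => /eqP.
      by rewrite eqn_exp2l // gtn_eqF.
    rewrite nth_default ?sQ; last first.
      by rewrite -ltnS prednK ?expn_gt0 ?(ltnW q_gt1) // -{1}(expn0 q) ltn_exp2l.
    move=> /esym/eqP; rewrite lead_coef_eq0 => /eqP P00.
    by move: P1; rewrite P00 size_poly0.
  have [z zQ] := root_ex Q Q1.
  have Qz : \sum_(i < size P) P`_i * iter i sigma z = z * Q.[z].
    rewrite /Q horner_sum mulr_sumr; apply: eq_bigr => i _.
    rewrite iterE hornerZ hornerXn mulrCA -exprS prednK //.
    by rewrite expn_gt0 (ltnW q_gt1).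
  exists z; last by rewrite Qz (rootP zQ) mulr0.
  apply: contraNneq P0 => z0; move: zQ; rewrite rootE z0 /Q horner_sum.
  rewrite -(ltn_predK P1) big_ord_recl big1 ?addr0 => [|i _].
    by rewrite hornerZ hornerXn expn0 /= expr0 mulr1.
  rewrite hornerZ hornerXn expr0n (_ : (_ == _) = false) ?mulr0 //.
  apply/negbTE; rewrite -lt0n -ltnS prednK ?expn_gt0 ?(ltnW q_gt1) //.
  by rewrite -{1}(expn0 q) ltn_exp2l.
by exists; exact: (FrobeniusField sK sinvK frob_inj fixed AS roots).
Qed.

End FrobeniusClosure.

(** * Skew Laurent polynomials *)

Section SkewOperators.
Variables (K : fieldType) (sigma : {rmorphism K -> K}).
Variables (S : nzRingType) (j : {rmorphism K -> S}) (x y : S).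
Hypotheses (xj : forall c, x * j c = j (sigma c) * x) (xy : x * y = 1) (yx : y *
  x = 1).
Implicit Types p q : {poly K}.

(** Commutative polynomials serve as coefficient lists for the skew polynomials in [x]. Evaluation
    respects sums, scalars on the left and powers of 'X on the right, but in general not
    products. *)
Definition skew_eval p : S := (map_poly j p).[x].
Local Notation ev := skew_eval.

Lemma skew_evalD p q : ev (p + q) = ev p + ev q.
Proof. by rewrite /ev rmorphD hornerD. Qed.

Lemma skew_evalN p : ev (- p) = - ev p.
Proof. by rewrite /ev rmorphN hornerN. Qed.

Lemma skew_evalC c : ev c%:P = j c.
Proof. by rewrite /ev map_polyC hornerC. Qed.

Lemma skew_eval0 : ev 0 = 0.
Proof. by rewrite /ev rmorph0 horner0. Qed.

Lemma skew_eval1 : ev 1 = 1.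
Proof. by rewrite /ev rmorph1 hornerC. Qed.

Lemma skew_evalCM c p : ev (c%:P * p) = j c * ev p.
Proof. by rewrite /ev rmorphM /= map_polyC hornerCM. Qed.

Lemma skew_evalMX p : ev (p * 'X) = ev p * x.
Proof. by rewrite /ev rmorphM /= map_polyX hornerMX. Qed.

Lemma skew_evalMXn p n : ev (p * 'X^n) = ev p * x ^+ n.
Proof.
elim: n => [|n IHn]; first by rewrite !expr0 !mulr1.
by rewrite !exprSr !mulrA skew_evalMX IHn.
Qed.

Lemma skew_eval_sum p : ev p = \sum_(i < size p) j p`_i * x ^+ i.
Proof.
rewrite /ev horner_coef size_map_poly; apply: eq_bigr => i _.
by rewrite coef_map.
Qed.

Lemma skew_eval_bigsum I (r : seq I) (P : pred I) (G : I -> {poly K}) :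
  ev (\sum_(i <- r | P i) G i) = \sum_(i <- r | P i) ev (G i).
Proof. exact: (big_morph _ skew_evalD skew_eval0). Qed.

(** Multiplication by [x] on the left, read on coefficient lists. *)
Definition twist p := 'X * map_poly sigma p.

Lemma skew_eval_twist p : ev (twist p) = x * ev p.
Proof.
rewrite /twist; elim/poly_ind: p => [|p c IHp].
  by rewrite rmorph0 mulr0 skew_eval0 mulr0.
rewrite rmorphD rmorphM /= map_polyX map_polyC /= mulrDr mulrA !skew_evalD.
rewrite skew_evalMX IHp mulrDr skew_evalMX mulrA; congr (_ + _).
by rewrite mulrC skew_evalMX !skew_evalC xj.
Qed.

Lemma skew_eval_iter_twist n p : ev (iter n twist p) = x ^+ n * ev p.
Proof.
elim: n => [|n IHn]; first by rewrite expr0 mul1r.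
by rewrite iterS skew_eval_twist IHn exprS mulrA.
Qed.

Lemma size_iter_twist n p : p != 0 -> size (iter n twist p) = (n + size p)%N.
Proof.
move=> p0; elim: n => // n IHn; rewrite iterS /twist mulrC size_mulX.
  by rewrite size_map_poly IHn addSn.
by rewrite map_poly_eq0 -size_poly_eq0 IHn addn_eq0 size_poly_eq0 (negPf p0) andbF.
Qed.

Lemma lead_coef_iter_twist n p :
  lead_coef (iter n twist p) = iter n sigma (lead_coef p).
Proof. by elim: n => // n IHn; rewrite !iterS /twist mulrC lead_coefMX
  lead_coef_map IHn. Qed.

Lemma iter_sigma_eq0 n c : (iter n sigma c == 0) = (c == 0).
Proof. by elim: n => // n IHn; rewrite iterS fmorph_eq0. Qed.

Lemma xX_field n c : x ^+ n * j c = j (iter n sigma c) * x ^+ n.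
Proof.
elim: n => [|n IHn]; first by rewrite !expr0 mulr1 mul1r.
by rewrite exprS -mulrA IHn mulrA xj -mulrA.
Qed.

Lemma skew_evalMj p z : ev p * j z = ev (\poly_(i < size p) (p`_i * iter i sigma z)).
Proof.
rewrite skew_eval_sum mulr_suml poly_def skew_eval_bigsum; apply: eq_bigr => i _.
rewrite -mul_polyC skew_evalCM -[X in _ * ev X]mul1r skew_evalMXn -mulrA xX_field.
by rewrite skew_eval1 mul1r rmorphM mulrA.
Qed.

Lemma skew_scaled_size (p : {poly K}) z : z != 0 ->
  size (\poly_(i < size p) (p`_i * iter i sigma z)) = size p.
Proof.
move=> z0; have [->|p0] := eqVneq p 0;
  first by rewrite size_poly0 poly_def big_ord0 size_poly0.
rewrite size_poly_eq // mulf_neq0 ?iter_sigma_eq0 //.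
by rewrite -lead_coefE lead_coef_eq0.
Qed.

Lemma yX_xX n : y ^+ n * x ^+ n = 1.
Proof.
elim: n => [|n IHn]; first by rewrite !expr0 mulr1.
by rewrite exprSr exprS mulrA -[_ * y * x]mulrA yx mulr1.
Qed.

Lemma field_y c : j c * y = y * j (sigma c).
Proof. by rewrite -[j c]mul1r -yx -!mulrA [x * _]mulrA xj -mulrA xy mulr1. Qed.

(** * Finite generation over the skew Laurent polynomials *)

Section Stable.
Variable V : lmodType S.
Implicit Types (N : set V) (v b : V).

(** Stability under [K], [x] and [y] alone: chains of submodules over [S] are controlled by finite
    generation over the smaller ring of skew Laurent polynomials. *)
Record skew_stable N : Prop := SkewStable {
  stable0 : N 0;
  stableD : forall u v, N u -> N v -> N (u + v);
  stableZ : forall c v, N v -> N (j c *: v);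
  stable_x : forall v, N v -> N (x *: v);
  stable_y : forall v, N v -> N (y *: v) }.

Lemma submodule_stable N : submodule N -> skew_stable N.
Proof.
move=> sN; split=> [|u v|c v|v|v]; first exact: submodule0.
- exact: submoduleD.
- exact: submoduleZ.
- exact: submoduleZ.
- exact: submoduleZ.
Qed.

Lemma stable_xX N n v : skew_stable N -> N v -> N (x ^+ n *: v).
Proof.
move=> sN Nv; elim: n => [|n IHn]; first by rewrite expr0 scale1r.
by rewrite exprS -scalerA; exact: stable_x.
Qed.

Lemma stable_yX N n v : skew_stable N -> N (x ^+ n *: v) -> N v.
Proof.
move=> sN Nv; rewrite -[v]scale1r -(yX_xX n) -scalerA; move: (_ *: v) Nv => w Nw.
elim: n => [|n IHn].
  by rewrite expr0 scale1r.
by rewrite exprS -scalerA; exact: stable_y.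
Qed.

Lemma stableB N u v : skew_stable N -> N u -> N v -> N (u - v).
Proof.
move=> sN Nu Nv; apply: stableD => //; rewrite -scaleN1r -(rmorphN1 j).
exact: stableZ.
Qed.

Definition skew_span (bs : seq V) v : Prop :=
  forall N, skew_stable N -> (forall b, b \in bs -> N b) -> N v.

Lemma skew_span_stable bs : skew_stable (skew_span bs).
Proof.
split=> [|u v Nu Nv|c v Nv|v Nv|v Nv] N sN bN; first exact: stable0.
- by apply: stableD => //; [exact: Nu | exact: Nv].
- by apply: stableZ => //; exact: Nv.
- by apply: stable_x => //; exact: Nv.
- by apply: stable_y => //; exact: Nv.
Qed.

Lemma mem_skew_span bs b : b \in bs -> skew_span bs b.
Proof. by move=> bbs N _; apply. Qed.

Lemma skew_span_sub bs bs' v : {subset bs <= bs'} -> skew_span bs v -> skew_span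
  bs' v.
Proof. by move=> sub vbs N sN bN; apply: vbs => // b /sub; exact: bN. Qed.

(** This set is the sum of [N] and of the Laurent multiples of [b]; the power of [x] clears the
    negative exponents, so that ordinary polynomials suffice. *)
Lemma stable_adjoin N b : skew_stable N ->
  skew_stable [set v | exists s p, N (x ^+ s *: v - ev p *: b)].
Proof.
move=> sN; split.
- exists 0%N, 0; rewrite scaler0 skew_eval0 scale0r subr0; exact: (stable0 sN).
- move=> u w [s [p Hu]] [t [q Hw]].
  exists (s + t)%N, (iter t twist p + iter s twist q).
  rewrite scalerDr skew_evalD !skew_eval_iter_twist scalerDl opprD addrACA.
  rewrite {1}addnC !exprD -!scalerA -!scalerBr.
  by apply: (stableD sN); exact: (stable_xX _ sN).
- move=> c w [s [p Hw]]; exists s, ((iter s sigma c)%:P * p).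
  rewrite skew_evalCM scalerA xX_field -!scalerA -scalerBr; exact: (stableZ sN).
- move=> w [s [p Hw]]; exists s, (twist p).
  rewrite skew_eval_twist scalerA -exprSr exprS -!scalerA -scalerBr.
  exact: (stable_x sN).
move=> w [s [p Hw]]; exists s.+1, p.
by rewrite exprSr -scalerA [x *: (y *: w)]scalerA xy scale1r.
Qed.

Lemma skew_span_cons b bs v : skew_span (b :: bs) v ->
  exists s p, skew_span bs (x ^+ s *: v - ev p *: b).
Proof.
have sp := skew_span_stable bs => bv.
apply: (bv _ (stable_adjoin b sp)) => b'; rewrite inE => /predU1P[->|b'bs].
  exists 0%N, 1; rewrite expr0 skew_eval1 subrr; exact: (stable0 sp).
exists 0%N, 0; rewrite expr0 scale1r skew_eval0 scale0r subr0.
exact: mem_skew_span.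
Qed.

(* The Hilbert basis argument: among the nonzero leading terms p b modulo the
   span of bs, one of least size generates the others. *)
Lemma stable_finitely_generated bs N : skew_stable N -> N `<=` skew_span bs ->
  exists gs, (forall g, g \in gs -> N g) /\ N `<=` skew_span gs.
Proof.
elim: bs N => [|b bs IHbs] N sN Nbs.
  by exists [::]; split.
have sp := skew_span_stable bs.
(* The coefficients at [b] of elements of [N], modulo the span of [bs]. Elements with coefficient 0
   are handled by the induction hypothesis applied to the intersection of [N] with that span. *)
pose L p := exists2 v, N v & skew_span bs (v - ev p *: b).
have NI : skew_stable (N `&` skew_span bs).
  split=> [|u v [Nu bu] [Nv bv]|c v [Nv bv]|v [Nv bv]|v [Nv bv]].
  - by split; [exact: (stable0 sN) | exact: (stable0 sp)].
  - by split; [exact: (stableD sN) | exact: (stableD sp)].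
  - by split; [exact: (stableZ sN) | exact: (stableZ sp)].
  - by split; [exact: (stable_x sN) | exact: (stable_x sp)].
  - by split; [exact: (stable_y sN) | exact: (stable_y sp)].
have [gs [gsN gsS]] := IHbs _ NI (@subIsetr _ _ _).
have [[p0 [Lp0 p00]]|nL] := pselect (exists p, L p /\ p != 0); last first.
  exists gs; split=> [g /gsN[]//|v Nv]; apply: gsS; split=> //.
  have [s [p Hv]] := skew_span_cons (Nbs v Nv).
  apply: (stable_yX (n := s) sp); have [p0|p0] := eqVneq p 0.
    by rewrite p0 skew_eval0 scale0r subr0 in Hv.
  by case: nL; exists p; split=> //; exists (x ^+ s *: v) => //;
    exact: (stable_xX _ sN).
pose P n := `[< exists p, [/\ L p, p != 0 & size p = n] >].
have exP : exists n, P n by exists (size p0); apply/asboolP; exists p0.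
have [d /asboolP[g [[vg Nvg vgS] g0 sg]] d_min] := ex_minnP exP.
exists (vg :: gs); split=> [h|v Nv].
  by rewrite inE => /predU1P[->//|/gsN[]].
have sp' := skew_span_stable (vg :: gs).
have [s [p Hv]] := skew_span_cons (Nbs v Nv).
apply: (stable_yX (n := s) sp').
have := stable_xX s sN Nv; move: (x ^+ s *: v) Hv => {v Nv s}.
have [n] := ubnP (size p); elim: n p => // n IHn p sp_n v Hv Nv.
have [pz|pn0] := eqVneq p 0.
  rewrite pz skew_eval0 scale0r subr0 in Hv.
  apply: (@skew_span_sub gs) => [h hgs|]; first by rewrite inE hgs orbT.
  exact: gsS.
have dp : (d <= size p)%N by apply: d_min; apply/asboolP; exists p; split=> //;
  exists v.
(* Division by [g]: the shift by [x ^+ s] brings [g] to the size of [p], and [c] cancels the leading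
   coefficient. *)
pose s := (size p - d)%N; pose h := iter s twist g.
have sh : size h = size p by rewrite size_iter_twist // sg subnK.
have lh : lead_coef h != 0 by rewrite lead_coef_iter_twist iter_sigma_eq0
  lead_coef_eq0.
pose c := lead_coef p / lead_coef h.
pose p' := p - c%:P * h.
have sp'_lt : (size p' < size p)%N.
  have sp_gt0 : (0 < size p)%N by rewrite size_poly_gt0.
  rewrite -(prednK sp_gt0) ltnS; apply/leq_sizeP => i.
  rewrite leq_eqVlt => /predU1P[<-|].
    have hE : h`_(size p).-1 = lead_coef h by rewrite lead_coefE sh.
    by rewrite coefB coefCM hE -lead_coefE divfK ?subrr.
  rewrite (prednK sp_gt0) => pi.
  by rewrite coefB coefCM !nth_default ?sh // mulr0 subrr.
rewrite -[v](subrK (j c *: (x ^+ s *: vg))).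
apply: (stableD sp'); last first.
  by apply: (stableZ sp'); apply: (stable_xX _ sp'); apply: mem_skew_span;
    exact: mem_head.
apply: (IHn p').
- by apply: leq_trans sp'_lt _; rewrite -ltnS.
- rewrite skew_evalD skew_evalN skew_evalCM skew_eval_iter_twist.
  have -> : v - j c *: (x ^+ s *: vg) - (ev p - j c * (x ^+ s * ev g)) *: b =
      (v - ev p *: b) - j c *: (x ^+ s *: (vg - ev g *: b)).
    rewrite scalerBl -!scalerA !scalerBr !opprB [LHS]addrACA [RHS]addrACA.
    by congr (_ + _); rewrite addrC.
  by apply: (stableB sp) => //; apply: (stableZ sp); exact: (stable_xX _ sp).
by apply: (stableB sN) => //; apply: (stableZ sN); exact: (stable_xX _ sN).
Qed.

(** The union of the chain is stable, hence finitely generated over the skew Laurent polynomials,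
    and its generators already lie in one term. *)
Lemma skew_noetherian bs : (forall v, skew_span bs v) -> noetherian_module V.
Proof.
move=> bsV F sF Fle; pose N := [set v | exists i, F i v].
have FleD i d : F i `<=` F (i + d)%N.
  elim: d => [|d IHd]; first by rewrite addn0.
  by rewrite addnS; exact: subset_trans IHd (Fle _).
have Fmax i l v : F i v -> F (maxn i l) v.
  by move=> Fv; rewrite maxnE; exact: FleD.
have sN : skew_stable N.
  split=> [|u v [i Fu] [l Fv]|c v [i Fv]|v [i Fv]|v [i Fv]].
  - by exists 0%N; exact: submodule0.
  - exists (maxn i l); apply: submoduleD => //; first exact: Fmax.
    by rewrite maxnC; exact: Fmax.
  - by exists i; exact: submoduleZ.
  - by exists i; exact: submoduleZ.
  - by exists i; exact: submoduleZ.
have [gs [gsN Ngs]] := stable_finitely_generated sN (fun v _ => bsV v).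
have [n gsn] : exists n, forall g, g \in gs -> F n g.
  elim: gs gsN {Ngs} => [|g gs IHgs] gsN; first by exists 0%N.
  have [|n gsn] := IHgs; first by move=> h hgs; apply: gsN; rewrite inE hgs orbT.
  have [i Fg] := gsN g (mem_head _ _).
  exists (maxn i n) => h; rewrite inE => /predU1P[->|/gsn Fh]; first exact: Fmax.
  by rewrite maxnC; exact: Fmax.
exists n => i ni; apply/seteqP; split; last by rewrite -(subnKC ni); exact: FleD.
move=> v Fv; apply: (Ngs v); [by exists i | exact/submodule_stable | exact: gsn].
Qed.

End Stable.
End SkewOperators.

(** * Modules of finite length and their fixed vectors *)

Section SkewModules.
Variables (k : finFieldType) (A : falgType k) (n : nat).
Variable f : {lrmorphism A -> {ffun 'I_n -> k^o} | *:%R}.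
Hypothesis f_surj : forall y, exists x, f x = y.
Hypothesis f_ker : forall x, f x = 0 <-> @jacobson_radical A x.
Variable FF : frobenius_field k.
Local Notation K := (ff_field FF).
Local Notation iota := (@ff_inj _ FF).
Local Notation sigma := (@ff_frob _ FF).
Local Notation chi := (char_at f).
Local Notation sc := (@scalar_op k A).

(** Generators and relations of A (x)_k K[x, x^-1; sigma]; [sl_ind] says that the generators do
    generate. That the ring has not collapsed further is expressed through the modules it carries:
    scalar extensions of the modules over [A], and Laurent series. *)
Record skew_laurent (S : nzRingType) := SkewLaurent {
  sl_field : {rmorphism K -> S};
  sl_alg : {rmorphism A^c -> S};
  sl_x : S;
  sl_y : S;
  sl_x_field : forall c, sl_x * sl_field c = sl_field (sigma c) * sl_x;
  sl_xy : sl_x * sl_y = 1;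
  sl_yx : sl_y * sl_x = 1;
  sl_x_alg : forall a, sl_x * sl_alg a = sl_alg a * sl_x;
  sl_field_alg : forall c a, sl_field c * sl_alg a = sl_alg a * sl_field c;
  sl_scalar : forall c, sl_alg (sc c) = sl_field (iota c);
  sl_ind : forall P : S -> Prop, (forall a, P (sl_alg a)) -> (forall c, P
    (sl_field c)) ->
    P sl_x -> P sl_y -> (forall r s, P r -> P s -> P (r + s)) ->
    (forall r s, P r -> P s -> P (r * s)) -> forall r, P r }.

Variables (S : nzRingType) (SL : skew_laurent S).
Local Notation jK := (sl_field SL).
Local Notation jA := (sl_alg SL).
Local Notation x := (sl_x SL).
Local Notation y := (sl_y SL).
Local Notation ev := (skew_eval jK x).
Let xK := sl_x_field SL.
Let xy := sl_xy SL.
Let yx := sl_yx SL.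
Let xA := sl_x_alg SL.
Let KA := sl_field_alg SL.
Let scK := sl_scalar SL.

Lemma sl_xX_alg s a : x ^+ s * jA a = jA a * x ^+ s.
Proof. by apply/esym; apply: (@commrX _ (jA a) x); apply/esym; exact: xA. Qed.

Lemma sl_alg_y a : y * jA a = jA a * y.
Proof. by rewrite -[LHS]mulr1 -xy mulrA -[y * _ * x]mulrA -xA mulrA yx mul1r. Qed.

Lemma sl_field_y c : y * jK (sigma c) = jK c * y.
Proof. exact/esym/field_y. Qed.

Lemma sl_field_y' c : y * jK c = jK (ff_frob_inv c) * y.
Proof. by rewrite -sl_field_y ff_frobKV. Qed.

(** * Descent: bases of vectors fixed by x *)

Section OneModule.
Variable M : lmodType S.
Implicit Types (N : set M) (m v : M).

Lemma sl_submodule N : N 0 -> (forall u v, N u -> N v -> N (u + v)) ->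
  (forall c v, N v -> N (jK c *: v)) -> (forall a v, N v -> N (jA a *: v)) ->
  (forall v, N v -> N (x *: v)) -> (forall v, N v -> N (y *: v)) -> submodule N.
Proof.
move=> N0 ND NK NA Nx Ny; apply/submoduleP; split=> // r u v Nu Nv; apply: (ND) => //.
move: u Nu; apply: (@sl_ind _ SL (fun r => forall u, N u -> N (r *: u))) => //.
  by move=> r1 s Pr Ps u Nu; rewrite scalerDl; apply: (ND); [exact: Pr | exact: Ps].
by move=> r1 s Pr Ps u Nu; rewrite -scalerA; apply: Pr; exact: Ps.
Qed.

Definition eigen_mod N m (i : 'I_n) : Prop :=
  forall a : A, N (jA a *: m - jK (iota (chi i a)) *: m).

Lemma eigen_modZ N m i (r : S) : submodule N -> eigen_mod N m i ->
  (forall a, r * jA a = jA a * r) -> (forall c, r * jK (iota c) = jK (iota c) * r) ->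
  eigen_mod N (r *: m) i.
Proof.
move=> sN Em rA rK a; rewrite !scalerA -rA -rK -!scalerA -scalerBr.
exact: submoduleZ.
Qed.

Lemma sl_x_iota c : x * jK (iota c) = jK (iota c) * x.
Proof. by rewrite xK ff_frob_inj. Qed.

Lemma eigen_mod_x N m i : submodule N -> eigen_mod N m i -> eigen_mod N (x *: m) i.
Proof. by move=> sN Em; apply: eigen_modZ => // *; rewrite ?xA ?sl_x_iota. Qed.

Lemma eigen_mod_x1 N m i :
  submodule N -> eigen_mod N m i -> eigen_mod N ((x - 1) *: m) i.
Proof.
move=> sN Em; apply: eigen_modZ => // *.
  by rewrite mulrBl mulrBr xA mul1r mulr1.
by rewrite mulrBl mulrBr sl_x_iota mul1r mulr1.
Qed.

Lemma exists_eigen_mod N m : submodule N -> ~ N m ->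
  exists r i, ~ N (r *: m) /\ eigen_mod N (r *: m) i.
Proof.
move=> sN Nm.
have sNA : @submodule A^c (restriction M jA) N.
  apply/submoduleP; split; first exact: submodule0 sN.
  by move=> a u v Nu Nv; exact: (submoduleD sN (submoduleZ (jA a) sN Nu)).
have [a0 [i [Na0 a0E]]] := eigenvector_mod f_surj f_ker sNA Nm.
exists (jA a0), i; split=> // a; have := a0E a.
rewrite -[sc (chi i a) *: _]/(jA (sc (chi i a)) *: (jA a0 *: m)) scK.
by [].
Qed.

(** If no eigenvector outside [N] is fixed modulo [N], then [x - 1] maps these eigenvectors to one
    another. Simplicity of the quotient yields an eigenvector [m] and a nonzero [p] with [ev p *: m]
    in [N]. For [p] of least size, a suitable scalar [z] makes [x - 1] a right factor of
    [ev p * jK z], and the other factor sends the eigenvector [(x - 1) *: (jK z^-1 *: m)] into [N]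
    with a smaller size. *)
Lemma maximal_eigen_fixed N N' : maximal_submodule N N' ->
  exists m i, [/\ N' m, ~ N m, eigen_mod N m i & N (x *: m - m)].
Proof.
move=> [sN sN' NN' maxN].
pose E m := [/\ N' m, ~ N m & exists i, eigen_mod N m i].
suff : exists m, E m /\ N (x *: m - m).
  by move=> [m [[N'm Nm [i Em]] Hm]]; exists m, i.
apply: contrapT => nfix.
have E_x1 m : E m -> E ((x - 1) *: m).
  move=> Em; have [N'm Nm [i Emi]] := Em; split.
  - exact: submoduleZ.
  - by rewrite scalerBl scale1r => Hm; apply: nfix; exists m.
  by exists i; exact: eigen_mod_x1.
have [m0 Em0] : exists m, E m.
  have [m N'm Nm] : exists2 m, N' m & ~ N m.
    by move: NN' => [_ /nonsubset[v [? ?]]]; exists v.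
  have [r [i [Nr Er]]] := exists_eigen_mod sN Nm.
  by exists (r *: m); split=> //; [exact: submoduleZ | exists i].
have stN := submodule_stable jK x y sN.
pose P d := `[< exists m p, [/\ E m, p != 0, N (ev p *: m) & size p = d] >].
have exP : exists d, P d.
  have [u uE] : exists u, u = (x - 1) *: m0 by exists ((x - 1) *: m0).
  have [N'u Nu [i Eu]] : E u by rewrite uE; exact: E_x1.
  (* The sum of [N] and of the Laurent multiples of [u]. It is a submodule because [A] acts on [u]
     by scalars modulo [N], and maximality makes it all of [N'], so it contains [m0]. *)
  pose W := [set v | exists s p, N (x ^+ s *: v - ev p *: u)].
  have [W0 WD WK Wx Wy] := stable_adjoin xK xy u stN.
  have sW : submodule W.
    apply: sl_submodule => // a v [s [p Wv]].
    exists s, (\poly_(l < size p) (p`_l * iter l sigma (iota (chi i a)))).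
    rewrite -(skew_evalMj xK) scalerA.
    rewrite sl_xX_alg -!scalerA -[jA a *: _](subrK (jA a *: (ev p *: u))) -addrA
      -scalerBr.
    apply: submoduleD => //; first exact: submoduleZ.
    have -> : jA a *: (ev p *: u) = ev p *: (jA a *: u).
      rewrite !scalerA; congr (_ *: u); rewrite skew_eval_sum mulr_suml mulr_sumr.
      apply: eq_bigr => l _; by rewrite mulrA -KA -!mulrA sl_xX_alg.
    by rewrite -scalerBr; exact: submoduleZ.
  have NW : N `<=` W.
    by move=> v Nv; exists 0%N, 0; rewrite expr0 scale1r skew_eval0 scale0r subr0.
  have Wu : W u by exists 0%N, 1; rewrite expr0 skew_eval1 subrr; exact: submodule0.
  have WN' : W `<=` N'.
    move=> v [s [p Wv]]; have {Wv} : N' (x ^+ s *: v).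
      exact: submodule_subr sN' (NN'.1 _ Wv) (submoduleZ _ sN' N'u).
    by move=> /(submoduleZ (y ^+ s) sN'); rewrite scalerA yX_xX // scale1r.
  have WE : W = N' by have [WN|//] := maxN W sW NW WN'; case: Nu; rewrite -WN.
  have [s [q Wm]] : W m0 by rewrite WE; have [] := Em0.
  (* x - 1 multiplies on the right as the commutative polynomial 'X - 1, and
     'X^s - q * ('X - 1) is nonzero because its value at 1 is 1. *)
  exists (size ('X^s - q * ('X - 1))); apply/asboolP;
    exists m0, ('X^s - q * ('X - 1)).
  split=> //.
    apply: contraTneq (oner_neq0 K) => /(congr1 (horner^~ 1)).
    by rewrite !hornerE /= expr1n subrr mulr0 subr0 => ->; rewrite eqxx.
  have -> // : ev ('X^s - q * ('X - 1)) *: m0 = x ^+ s *: m0 - ev q *: u.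
  rewrite mulrBr mulr1 skew_evalD skew_evalN skew_evalD skew_evalN skew_evalMX.
  rewrite -['X^s]mul1r skew_evalMXn skew_eval1 mul1r scalerBl uE scalerA mulrBr mulr1.
  by [].
have [d /asboolP[m [p [Em p0 Npm sp]]] d_min] := ex_minnP exP.
have no_smaller m' p' : E m' -> p' != 0 -> N (ev p' *: m') -> (size p' < d)%N ->
  False.
  move=> Em' p'0 Np'; rewrite ltnNge => /negP; apply; apply: d_min.
  by apply/asboolP; exists m', p'.
have [N'm Nm [i Ei]] := Em.
(* A factor 'X of [p] could be moved onto [m], replacing it by the eigenvector [x *: m] and lowering
   the size. *)
have p_const : p`_0 != 0.
  apply/eqP => pz.
  have /factor_theorem[p1 p1E] : root p 0 by rewrite rootE horner_coef0 pz.
  rewrite subr0 in p1E.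
  have p10 : p1 != 0 by apply: contraNneq p0 => p10; rewrite p1E p10 mul0r.
  apply: (@no_smaller (x *: m) p1) => //.
  - split; [exact: submoduleZ | | by exists i; exact: eigen_mod_x].
    by move=> /(submoduleZ y sN); rewrite scalerA yx scale1r.
  - by move: Npm; rewrite p1E skew_evalMX scalerA.
  by rewrite -sp p1E size_mulX.
have p_size : (1 < size p)%N.
  rewrite ltnNge; apply/negP => /size1_polyC pC.
  apply: Nm; move: Npm; rewrite pC skew_evalC => /(submoduleZ (jK (p`_0)^-1) sN).
  by rewrite scalerA -rmorphM mulVf // rmorph1 scale1r.
(* p(x) z has coefficients p`_l * sigma^l(z), whose sum is 0, so that it factors
   as g(x) (x - 1), contradicting the minimality of p. *)
have [z z0 zE] := ff_root p_const p_size.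
pose m' := jK z^-1 *: m.
have Em' : E m'.
  split; first exact: submoduleZ.
    move=> /(submoduleZ (jK z) sN); rewrite scalerA -rmorphM divff //.
    by rewrite rmorph1 scale1r.
  exists i; apply: eigen_modZ => // *; rewrite ?KA //.
  by rewrite -!rmorphM mulrC.
pose pz := \poly_(l < size p) (p`_l * iter l sigma z).
have /factor_theorem[g gE] : root pz 1.
  rewrite rootE /pz horner_poly; under eq_bigr do rewrite expr1n mulr1.
  by rewrite zE.
have pz0 : pz != 0 by rewrite -size_poly_eq0 skew_scaled_size // size_poly_eq0.
have g0 : g != 0 by apply: contraNneq pz0 => g0; rewrite gE g0 mul0r.
apply: (@no_smaller ((x - 1) *: m') g) => //; first exact: E_x1.
  have : N (ev pz *: m').
    by rewrite -(skew_evalMj xK) scalerA -mulrA -rmorphM divff // rmorph1 mulr1.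
  rewrite gE mulrBr mulr1 skew_evalD skew_evalN skew_evalMX scalerA mulrBr mulr1.
  by [].
rewrite -sp -(skew_scaled_size sigma p z0) -/pz gE size_Mmonic ?monicXsubC //.
by rewrite size_XsubC addn2.
Qed.

Lemma sl_field_scale_comb d (w : 'I_d -> M) c : (forall i, x *: w i = w i) ->
  x *: comb jK w c = comb jK w (fun i => sigma (c i)).
Proof.
move=> xw; rewrite scaler_sumr; apply: eq_bigr => i _.
by rewrite scalerA xK -scalerA xw.
Qed.

(** A composition factor supplies [m] with [x *: m - m] equal to a combination of the fixed vectors
    already found, with coefficients [c i]. Adding the combination with coefficients z_i, where
    sigma(z_i) - z_i = - c_i, makes [m] fixed exactly. *)
Lemma fixed_basis : finite_length M -> exists d (w : 'I_d -> M),
  [/\ spans jK w setT, free_family jK w & forall i, x *: w i = w i].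
Proof.
move=> [l [F [F0 Fl Fmax]]]; rewrite -Fl.
suff H i : (i <= l)%N -> exists d (w : 'I_d -> M),
    [/\ spans jK w (F i), free_family jK w & forall i, x *: w i = w i].
  exact: H.
elim: i => [|i IHi] il.
  exists 0%N, (fun=> 0); split=> [v|c _ [//]|[//]].
  rewrite F0; split=> [->|[c ->]]; last by rewrite /comb big_ord0.
  by exists (fun=> 0); rewrite /comb big_ord0.
have [d [w [wF w_free xw]]] := IHi (ltnW il).
have maxF := Fmax i il; have [sN sN' NN' _] := maxF.
have [m [s [N'm Nm Em xm]]] := maximal_eigen_fixed maxF.
have [c cE] := (wF _).1 xm.
have [z zE] := choice (fun i => ff_artin_schreier (- c i)).
pose m' := m + comb jK w z.
have xm' : x *: m' = m'.
  rewrite scalerDr sl_field_scale_comb // -[x *: m](subrK m) cE /m'.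
  rewrite addrAC addrC -combD; congr (_ + _); apply: eq_bigr => r _.
  by rewrite -[sigma _](subrK (z r)) zE addrA subrr add0r.
have wz : F i (comb jK w z) by apply/wF; exists z.
have Nm' : ~ F i m' by move=> Hm'; apply: Nm; rewrite -[m](addrK (comb jK w z));
  exact: submoduleB.
exists d.+1, (cons_family m' w); split.
- apply: spans_cons wF _ => v.
  (* Modulo [F i] the whole ring preserves the [K]-line of [m]; this is checked on generators, [y]
     being covered because [m - y *: m] is [y] applied to [x *: m - m]. *)
  have rm r : forall c, exists c', F i (r *: (jK c *: m) - jK c' *: m).
    apply: (@sl_ind _ SL (fun r => forall c, exists c', F i (r *: (jK c *: m) -
      jK c' *: m))).
    - move=> a b; exists (b * iota (chi s a)); rewrite rmorphM -[X in _ - X]scalerA.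
      by rewrite scalerA -KA -scalerA -scalerBr; exact: submoduleZ.
    - by move=> b b'; exists (b * b'); rewrite rmorphM scalerA subrr;
      exact: submodule0.
    - move=> b; exists (sigma b); rewrite scalerA xK -scalerA -scalerBr.
      exact: submoduleZ.
    - move=> b; exists (ff_frob_inv b);
      rewrite scalerA sl_field_y' -scalerA -scalerBr.
      apply: submoduleZ => //; rewrite -opprB; apply: submoduleN => //.
      rewrite -[X in X - _]scale1r -yx -scalerA -scalerBr; exact: submoduleZ.
    - move=> r1 t Pr Pt b; have [b1 H1] := Pr b; have [b2 H2] := Pt b.
      exists (b1 + b2); rewrite rmorphD !scalerDl opprD addrACA; exact: submoduleD.
    move=> r1 t Pr Pt b; have [b1 H1] := Pt b; have [b2 H2] := Pr b1.
    exists b2; rewrite -scalerA -[_ *: (t *: _)](subrK (r1 *: (jK b1 *: m))) -addrA.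
    by apply: submoduleD => //; rewrite -scalerBr; exact: submoduleZ.
  have := maximal_submodule_line maxF N'm Nm rm v; rewrite /m' => ->.
  split=> -[a Ha]; exists a.
    by rewrite scalerDr opprD addrA; apply: submoduleB => //;
      exact: (submoduleZ _ sN wz).
  move: Ha; rewrite scalerDr opprD addrA => Ha.
  by rewrite -[_ - _](subrK (jK a *: comb jK w z)); apply: submoduleD => //;
    exact: (submoduleZ _ sN wz).
- exact: free_cons wF w_free Nm'.
by move=> r; rewrite /cons_family; case: (unliftP ord0 r) => [b _|_];
  [exact: xw | exact: xm'].
Qed.

End OneModule.

(** * The functor of fixed vectors *)

Section Fixed.
Variable M : lmodType S.

Definition fixed_set : set (restriction M jA) := [set v | x *: (v : M) = v].

Lemma fixed_submodule : submodule fixed_set.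
Proof.
apply/submoduleP; split=> /= [|a u v xu xv]; first exact: scaler0.
change (x *: (jA a *: (u : M) + (v : M)) = jA a *: (u : M) + (v : M)).
rewrite scalerDr xv; congr (_ + _); by rewrite scalerA xA -scalerA xu.
Qed.

Definition fixed_module : lmodType A^c := submod_of fixed_submodule.

Definition fixed_val (u : fixed_module) : M := val u.

Lemma fixed_valP u : x *: fixed_val u = fixed_val u.
Proof. by have := submod_valP (sN := fixed_submodule) u. Qed.

Definition fixed_elt v (xv : x *: v = v) : fixed_module :=
  @submod_elt _ _ _ fixed_submodule v xv.

Lemma fixed_eltK v (xv : x *: v = v) : fixed_val (fixed_elt xv) = v.
Proof. by rewrite /fixed_val submod_eltK. Qed.

Lemma fixed_val_inj : injective fixed_val.
Proof. exact: val_inj. Qed.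

Lemma fixed_valD u v : fixed_val (u + v) = fixed_val u + fixed_val v.
Proof. by []. Qed.

Lemma fixed_valZ (a : A^c) u : fixed_val (a *: u) = jA a *: fixed_val u.
Proof. by []. Qed.

Lemma fixed_val0 : fixed_val 0 = 0.
Proof. by []. Qed.

Lemma fixed_val_comb d (w : 'I_d -> fixed_module) c :
  fixed_val (comb sc w c) = comb jK (fixed_val \o w) (fun i => iota (c i)).
Proof.
rewrite /comb (big_morph fixed_val fixed_valD fixed_val0); apply: eq_bigr => i _.
by rewrite fixed_valZ scK.
Qed.

(** Applying [x] applies sigma to the coordinates and leaves [u] unchanged; by freeness the
    coordinates are fixed by sigma, hence come from [k]. *)
Lemma fixed_coords d (w : 'I_d -> fixed_module) (u : fixed_module) c :
  free_family jK (fixed_val \o w) -> fixed_val u = comb jK (fixed_val \o w) c ->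
  exists c', u = comb sc w c'.
Proof.
move=> w_free uc.
have cfix i : sigma (c i) = c i.
  apply: (free_family_inj w_free (c := fun i => sigma (c i))).
  rewrite -sl_field_scale_comb; last by move=> l; exact: fixed_valP.
  by rewrite -uc fixed_valP.
have [c' cE] := choice (fun i => ff_fixed (cfix i)).
exists c'; apply: fixed_val_inj; rewrite fixed_val_comb uc.
by apply: eq_bigr => i _; rewrite cE.
Qed.

Lemma fixed_module_basis : finite_length M -> exists d (w : 'I_d -> fixed_module),
  [/\ forall v, exists c, v = comb jK (fixed_val \o w) c,
      free_family jK (fixed_val \o w) & forall u, exists c, u = comb sc w c].
Proof.
move=> Mfin; have [d [w [w_span w_free xw]]] := fixed_basis Mfin.
pose w' i := fixed_elt (xw i); exists d, w'.
have wE : fixed_val \o w' = w by apply/funext => i /=; rewrite fixed_eltK.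
have w_span' v : exists c, v = comb jK w c by apply/w_span.
rewrite wE; split=> // u; have [c uc] := w_span' (fixed_val u).
by apply: (@fixed_coords _ _ _ c); rewrite wE.
Qed.

Lemma fixed_module_finite_length : finite_length M -> finite_length fixed_module.
Proof.
move=> /fixed_module_basis[d [w [_ _ w_span]]].
exact: finite_length_spans w_span.
Qed.

End Fixed.

Fact fixed_map_proof (M N : lmodType S) (g : {linear M -> N}) (u : fixed_module M) :
  x *: g (fixed_val u) = g (fixed_val u).
Proof. by rewrite -linearZ fixed_valP. Qed.

Fact fixed_map_linear (M N : lmodType S) (g : {linear M -> N}) :
  linear (fun u => fixed_elt (fixed_map_proof g u)).
Proof.
move=> a u v; apply: fixed_val_inj.
rewrite [LHS]fixed_eltK [RHS]fixed_valD [in RHS]fixed_valZ !fixed_eltK.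
by rewrite fixed_valD fixed_valZ linearD linearZ.
Qed.

Definition fixed_map (M N : lmodType S) (g : {linear M -> N}) :
    {linear fixed_module M -> fixed_module N} :=
  linear_map (fixed_map_linear g).

Lemma fixed_mapE (M N : lmodType S) (g : {linear M -> N}) u :
  fixed_val (fixed_map g u) = g (fixed_val u).
Proof. exact: fixed_eltK. Qed.

Lemma fixed_map_faithful (M N : lmodType S) (g g' : {linear M -> N}) :
  finite_length M -> fixed_map g = fixed_map g' -> g = g'.
Proof.
move=> /fixed_module_basis[d [w [w_span _ _]]] gg'; apply: linear_ext => v.
have [c ->] := w_span v; rewrite !linear_sum; apply: eq_bigr => i _.
by rewrite !linearZ /= -!fixed_mapE gg'.
Qed.

(** The map [g] is the [K]-linear extension of [h] along a basis of fixed vectors. It commutes with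
    [A] because [h] does, with [x] because the basis and its image are fixed, and with [y] because
    [y] inverts [x]. *)
Lemma fixed_map_full (M N : lmodType S) (h : {linear fixed_module M ->
  fixed_module N}) :
  finite_length M -> exists g : {linear M -> N}, fixed_map g = h.
Proof.
move=> /fixed_module_basis[d [w [w_span w_free w_span']]].
pose hw i := fixed_val (h (w i)).
have [co coE] := choice w_span.
pose g v := comb jK hw (co v).
have g_comb c : g (comb jK (@fixed_val M \o w) c) = comb jK hw c.
  apply: eq_bigr => i _; congr (jK _ *: _).
  by apply: (free_family_inj w_free); rewrite -coE.
have gD u v : g (u + v) = g u + g v.
  by rewrite [u in LHS]coE [v in LHS]coE -combD g_comb combD.
have gK c v : g (jK c *: v) = jK c *: g v.
  by rewrite [v in LHS]coE -combZ g_comb combZ.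
have g0 : g 0 = 0 by rewrite -(scale0r (0 : M)) -(rmorph0 jK) gK rmorph0 scale0r.
have g_sum I (r : seq I) (P : pred I) G : g (\sum_(i <- r | P i) G i) = \sum_(i
  <- r | P i) g (G i).
  exact: (big_morph g gD g0).
have g_fixed u : g (fixed_val u) = fixed_val (h u).
  have [c ->] := w_span' u.
  rewrite fixed_val_comb g_comb linear_sum (big_morph _ (@fixed_valD N)
    (@fixed_val0 N)).
  by apply: eq_bigr => i _; rewrite linearZ fixed_valZ scK.
have gx v : g (x *: v) = x *: g v.
  rewrite [v in LHS]coE sl_field_scale_comb; last by move=> i; exact: fixed_valP.
  by rewrite g_comb -sl_field_scale_comb // => i; exact: fixed_valP.
have gS r v : g (r *: v) = r *: g v.
  move: v; apply: (@sl_ind _ SL (fun r => forall v, g (r *: v) = r *: g v)) => //.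
  - move=> a v; rewrite [v in LHS]coE [g v](_ : _ = comb jK hw (co v)) //
    !scaler_sumr g_sum.
    apply: eq_bigr => i _; rewrite !scalerA -KA -!scalerA gK; congr (_ *: _).
    by rewrite -fixed_valZ g_fixed linearZ fixed_valZ.
  - by move=> v; rewrite -[v in RHS]scale1r -xy -scalerA gx [RHS]scalerA yx scale1r.
  - by move=> r1 r2 H1 H2 v; rewrite !scalerDl gD H1 H2.
  by move=> r1 r2 H1 H2 v; rewrite -!scalerA H1 H2.
have g_lin : linear g by move=> r u v; rewrite gD gS.
exists (linear_map g_lin); apply: linear_ext => u; apply: fixed_val_inj.
by rewrite fixed_mapE -g_fixed.
Qed.

Definition fixed_functor :
    functor (module_category (@finite_length S)) (module_category (@finite_length
      A^c)).
Proof.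
refine (@Functor (module_category (@finite_length S)) (module_category
  (@finite_length A^c))
  (fun M => exist _ (fixed_module (sval M)) (fixed_module_finite_length (svalP M)))
  (fun M N g => fixed_map g) _ _).
  by move=> M; apply: linear_ext => u; apply: fixed_val_inj; rewrite fixed_mapE.
by move=> M N L g h; apply: linear_ext => u; apply: fixed_val_inj;
  rewrite /= !fixed_eltK.
Defined.

(* Y is X (x)_k K, with x acting as the Frobenius map of K. *)
Definition scalar_extension (X : lmodType A^c) d (w : 'I_d -> X) (Y : lmodType S)
    (eta : X -> Y) : Prop :=
  [/\ forall u v, eta (u + v) = eta u + eta v,
      forall a u, eta (a *: u) = jA a *: eta u, forall u, x *: eta u = eta u,
      free_family jK (eta \o w) & forall v, exists c, v = comb jK (eta \o w) c].

(** For essential surjectivity, [eta] identifies [X] with the fixed vectors of [Y]: it is onto by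
    [fixed_coords] and injective because the image of the basis is free. *)
Lemma fixed_functor_equivalence :
  (forall (X : lmodType A^c) d (w : 'I_d -> X), spans sc w setT -> free_family sc w ->
    exists (Y : lmodType S) (eta : X -> Y), scalar_extension w eta) ->
  equivalent_categories (module_category (@finite_length A^c))
    (module_category (@finite_length S)).
Proof.
move=> ext; apply: (fully_faithful_equivalence (G := fixed_functor)).
  move=> [M Mfin] [N Nfin] /= h; have [g gh] := fixed_map_full h Mfin.
  by exists g; split=> // g' g'h; apply: fixed_map_faithful => //; rewrite gh g'h.
move=> [X Xfin].
have [d [w [w_span w_free]]] := elementary_finite_length_basis f_surj f_ker Xfin.
have [Y [eta [etaD etaZ etax eta_free eta_span]]] := ext X d w w_span w_free.
have Yfin : finite_length Y by exact: finite_length_spans eta_span.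
pose e u := fixed_elt (etax u).
have e_lin : linear e.
  move=> a u v; apply: fixed_val_inj.
  by rewrite [RHS]fixed_valD [in RHS]fixed_valZ !fixed_eltK etaD etaZ.
have eE : @fixed_val Y \o (e \o w) = eta \o w by apply/funext => i; exact: fixed_eltK.
have e_comb c : e (comb sc w c) = comb sc (e \o w) c.
  rewrite -[e]/(linear_map e_lin : X -> _) linear_sum.
  by apply: eq_bigr => i _; rewrite linearZ.
have e_surj u : exists v, e v = u.
  have [c uc] := eta_span (fixed_val u).
  have [c' ->] : exists c', u = comb sc (e \o w) c'.
    by apply: (@fixed_coords _ _ _ _ c); rewrite eE.
  by exists (comb sc w c').
have e_inj v : e v = 0 -> v = 0.
  have [c ->] := (w_span v).1 I; rewrite e_comb => /(congr1 (@fixed_val _)).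
  rewrite fixed_val_comb eE => /eta_free c0.
  rewrite -(comb0 sc w); apply: eq_bigr => i _.
  by have /eqP := c0 i; rewrite fmorph_eq0 => /eqP->.
have [e' e'E] := choice e_surj.
have e'K v : e' (e v) = v.
  apply/eqP; rewrite -subr_eq0; apply/eqP; apply: e_inj.
  by rewrite -[e]/(linear_map e_lin : X -> _) linearB /= e'E subrr.
have e'_lin : linear e'.
  move=> a u v; rewrite -[u in LHS]e'E -[v in LHS]e'E -[RHS]e'K; congr e'.
  by rewrite -[e]/(linear_map e_lin : X -> _) linearD linearZ.
exists (exist _ Y Yfin), (linear_map e'_lin), (linear_map e_lin).
by split; apply: linear_ext => u /=; rewrite ?e'K ?e'E.
Qed.

(** It suffices to map [X] into any module where the image of the basis is free over [K]: the
    [K]-span of that image is a submodule. *)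
Lemma scalar_extension_sub (X : lmodType A^c) d (w : 'I_d -> X) (Z : lmodType S)
    (eta : X -> Z) : spans sc w setT ->
  (forall u v, eta (u + v) = eta u + eta v) ->
  (forall a u, eta (a *: u) = jA a *: eta u) -> (forall u, x *: eta u = eta u) ->
  free_family jK (eta \o w) ->
  exists (Y : lmodType S) (eta' : X -> Y), scalar_extension w eta'.
Proof.
move=> w_span etaD etaZ etax eta_free.
pose W := [set v | exists c, v = comb jK (eta \o w) c].
have WD u v : W u -> W v -> W (u + v).
  by move=> [c ->] [c' ->]; exists (fun i => c i + c' i); rewrite combD.
have WK c v : W v -> W (jK c *: v).
  by move=> [c' ->]; exists (fun i => c * c' i); rewrite combZ.
have W0 : W 0 by exists (fun=> 0); rewrite comb0.
have eta0 : eta 0 = 0 by rewrite -(scale0r (0 : X)) etaZ rmorph0 scale0r.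
have Weta u : W (eta u).
  have [c ->] := (w_span u).1 I; exists (fun i => iota (c i)).
  rewrite /comb (big_morph eta etaD eta0); apply: eq_bigr => i _.
  by rewrite etaZ scK.
have xw i : x *: (eta \o w) i = (eta \o w) i by exact: etax.
have sW : submodule W.
  apply: sl_submodule => // [a v [c ->]|v [c ->]|v [c ->]].
  - rewrite scaler_sumr; elim/big_ind: _ => // i _.
    by rewrite scalerA -KA -scalerA -etaZ; apply: WK; exact: Weta.
  - by exists (fun i => sigma (c i)); rewrite sl_field_scale_comb.
  exists (fun i => ff_frob_inv (c i)); rewrite scaler_sumr; apply: eq_bigr => i _.
  rewrite scalerA sl_field_y' -scalerA; congr (_ *: _).
  by rewrite -[in LHS]xw scalerA yx scale1r.
exists (submod_of sW), (fun u => submod_elt sW (Weta u)).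
have valE c : val (comb jK ((fun u => submod_elt sW (Weta u)) \o w) c) =
    comb jK (eta \o w) c.
  rewrite /comb linear_sum; apply: eq_bigr => i _.
  by rewrite linearZ.
split=> [u v|a u|u|c cz|v].
- by apply: val_inj; rewrite linearD /= etaD.
- by apply: val_inj; rewrite linearZ /= etaZ.
- by apply: val_inj; rewrite linearZ /= etax.
- by apply: eta_free; rewrite -valE cz linear0.
by have [c vc] := submod_valP v; exists c; apply: val_inj; rewrite valE.
Qed.

(** Full faithfulness carries the division property to the endomorphisms of the fixed module, which
    is then a line over [k]; a vector spanning it spans [M] over [K]. *)
Lemma skew_CSL : right_quiver_totally_disconnected A -> has_CSL (@finite_length S).
Proof.
move=> hQ M Mfin [Mid Mdiv].
have [d [w [w_span w_free w_span']]] := fixed_module_basis Mfin.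
have Gdiv : division_endomorphism_ring (fixed_module M).
  split=> [id0|h h0].
    apply: Mid; apply/funext => v; have [c ->] := w_span v.
    rewrite /comb big1 //= => i _; have /= := congr1 (@^~ (w i)) id0.
    by move=> /(congr1 (@fixed_val M)) ->; rewrite fixed_val0 scaler0.
  have [g gh] := fixed_map_full h Mfin.
  have [|g' [g'g gg']] := Mdiv g.
    move=> g0; apply: h0; rewrite -gh; apply/funext => u; apply: fixed_val_inj.
    by rewrite fixed_mapE g0.
  exists (fixed_map g'); rewrite -gh; split; apply/funext => u; apply: fixed_val_inj.
    by rewrite /= !fixed_mapE; have := congr1 (@^~ (fixed_val u)) g'g.
  by rewrite /= !fixed_mapE; have := congr1 (@^~ (fixed_val u)) gg'.
have [s [i [sn _ s_span]]] := elementary_CSL_line f_surj f_ker hQ Gdiv.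
apply: (@line_simple _ _ jK _ (fixed_val s)).
  by move=> s0; apply: sn; apply: fixed_val_inj.
move=> v; have [c ->] := w_span v.
have [b bE] := choice (fun l => s_span (w l)).
exists (\sum_l c l * iota (b l)); rewrite rmorph_sum scaler_suml.
by apply: eq_bigr => l _; rewrite /= bE fixed_valZ scK rmorphM scalerA.
Qed.

(** * The module of fractions *)

Lemma linear_inverse (R : nzRingType) (M N : lmodType R) (h : {linear M -> N}) :
  injective h -> (forall v, exists u, h u = v) ->
  exists g : {linear N -> M}, g \o h = idfun /\ h \o g = idfun.
Proof.
move=> h_inj /choice[g hg].
have g_lin : linear g by move=> a u v; apply: h_inj; rewrite hg linearD linearZ !hg.
by exists (linear_map g_lin); split; apply/funext => u /=; rewrite ?hg //;
  apply: h_inj; rewrite hg.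
Qed.

Lemma simple_finite_length (R : nzRingType) (M : lmodType R) :
  simple_module M -> finite_length M.
Proof.
move=> [[m m0] Msimple]; exists 1%N, (fun i => if i is 0%N then [set 0] else setT).
split=> // -[|//] _; split=> [|||K sK _ _];
  [exact: submodule_set0 | exact: submoduleT | |].
  by split=> // /(_ m I).
exact: Msimple.
Qed.

(** Only the existence of a coefficient list for the product is recorded; that it is nonzero will be
    read off from an action. *)
Lemma skew_eval_mul p q : exists r, ev p * ev q = ev r.
Proof.
exists (\sum_(i < size p) (p`_i)%:P * iter i (twist sigma) q).
rewrite [ev p]skew_eval_sum mulr_suml skew_eval_bigsum; apply: eq_bigr => i _.
by rewrite skew_evalCM (skew_eval_iter_twist xK) mulrA.
Qed.

(* A nonzero kernel vector of the matrix whose rows are the x^i p and the x^l q: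
   it has one more row than columns. *)
Lemma skew_ore p q : p != 0 -> q != 0 ->
  exists r t, (r != 0 \/ t != 0) /\ ev r * ev p = ev t * ev q.
Proof.
move=> p0 q0; pose a := size q; pose b := size p.
have ab : (0 < a + b)%N by rewrite addn_gt0 size_poly_gt0 q0.
(* The sign on the second family turns the relation between rows into the required equality. All
   rows have size at most [(a + b).-1], one less than their number. *)
pose row (i : 'I_(a + b)) : {poly K} := match fintype.split i with
  inl i => iter i (twist sigma) p | inr i => - iter i (twist sigma) q end.
have row_size i : (size (row i) <= (a + b).-1)%N.
  rewrite /row; case: fintype.split => l;
    rewrite ?size_polyN size_iter_twist // -ltnS prednK //.
    by rewrite ltn_add2r.
  by rewrite addnC ltn_add2l.
pose X := \matrix_(i < a + b, l < (a + b).-1) (row i)`_l.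
have [c c0 cX] : exists2 c : 'rV_(a + b), c != 0 & c *m X = 0.
  have : kermx X != 0.
    rewrite kermx_eq0 /row_free ltn_eqF // (leq_ltn_trans (rank_leq_col X)) //.
    by rewrite prednK.
  by move=> /rowV0Pn[c /sub_kermxP cX c0]; exists c.
have rowE : \sum_i (c 0 i)%:P * row i = 0.
  apply/polyP => l; rewrite coef0 coef_sum.
  have [lt|le] := ltnP l (a + b).-1.
    have E0 : \sum_i c 0 i * X i (Ordinal lt) = 0.
      have := congr1 (fun Z : 'rV_(a + b).-1 => Z 0 (Ordinal lt)) cX.
      by rewrite mxE [RHS]mxE.
    by rewrite -[RHS]E0; apply: eq_bigr => i _; rewrite coefCM mxE.
  rewrite big1 // => i _; rewrite coefCM nth_default ?mulr0 //.
  exact: leq_trans (row_size i) le.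
exists (\poly_(i < a) oapp (c 0) 0 (insub i)), (\poly_(i < b) oapp (c 0) 0 (insub
  (a + i)%N)).
split.
  have [i ci] : exists i, c 0 i != 0.
    apply/existsP; apply: contraNT c0; rewrite negb_exists => /forallP cz.
    by apply/eqP/rowP => i; rewrite mxE; apply/eqP; move: (cz i); rewrite negbK.
  case: (split_ordP i) ci => l -> cl; [left|right].
    apply: contraNneq cl => /(congr1 (fun P : {poly K} => P`_l)).
    rewrite coef0 coef_poly ltn_ord insubT; first by rewrite ltn_addr.
    by move=> lt /= <-; apply/eqP; congr (c 0 _); apply: val_inj.
  apply: contraNneq cl => /(congr1 (fun P : {poly K} => P`_l)).
  rewrite coef0 coef_poly ltn_ord insubT; first by rewrite ltn_add2l.
  by move=> lt /= <-; apply/eqP; congr (c 0 _); apply: val_inj.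
have := congr1 ev rowE; rewrite skew_eval0 skew_eval_bigsum big_split_ord /=.
have evC n1 (g : nat -> K) (P : {poly K}) :
    \sum_(i < n1) ev ((g i)%:P * iter i (twist sigma) P) = ev (\poly_(i < n1) g
      i) * ev P.
  rewrite poly_def skew_eval_bigsum mulr_suml; apply: eq_bigr => i _.
  rewrite skew_evalCM (skew_eval_iter_twist xK) -mul_polyC skew_evalCM.
  by rewrite -[X in _ * ev X * _]mul1r skew_evalMXn skew_eval1 mul1r mulrA.
move=> /eqP; rewrite addr_eq0 => /eqP E.
rewrite -!evC -[RHS]opprK -[X in _ = - X]sumrN.
have -> : \sum_(i < a) ev ((oapp (c 0) 0 (insub (i : nat) : option 'I_(a + b)))%:P
    * iter i (twist sigma) p) = \sum_(i < a) ev ((c 0 (lshift b i))%:P * row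
      (lshift b i)).
  apply: eq_bigr => i _; rewrite /row -[lshift b i]/(unsplit (inl i)) unsplitK.
  rewrite insubT; first by rewrite ltn_addr.
  by move=> lt /=; congr (ev ((c 0 _)%:P * _)); apply: val_inj.
rewrite E; congr (- _); apply: eq_bigr => i _.
rewrite /row -[rshift a i]/(unsplit (inr i)) unsplitK mulrN skew_evalN; congr (- _).
rewrite insubT; first by rewrite ltn_add2l.
by move=> lt /=; congr (ev ((c 0 _)%:P * _)); apply: val_inj.
Qed.

(* A rank one torsion-free divisible module; its endomorphism ring is the
   opposite of the division ring of fractions of K[x, x^-1; sigma]. *)
Lemma divisible_not_CSL (Z : lmodType S) (E : set Z) (i : 'I_n) (u0 : Z) :
  submodule E -> E u0 -> u0 <> 0 ->
  (forall a u, E u -> jA a *: u = jK (iota (chi i a)) *: u) ->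
  (forall p u, p != 0 -> E u -> ev p *: u = 0 -> u = 0) ->
  (forall p u, p != 0 -> E u -> exists2 u', E u' & ev p *: u' = u) ->
  ~ has_CSL (@all_modules S).
Proof.
move=> sE Eu0 u0n EA Einj Esurj CSL.
(* If the product were 0 it would kill [u0], against injectivity of both factors on [E]. *)
have mul_neq0 p q r : p != 0 -> q != 0 -> ev p * ev q = ev r -> r != 0.
  move=> p0 q0 pqr; apply/eqP => r0; apply: u0n.
  apply: (Einj q) => //; apply: (Einj p) => //; first exact: submoduleZ.
  by rewrite scalerA pqr r0 skew_eval0 scale0r.
have ore p q : p != 0 -> q != 0 -> exists r t,
    [/\ r != 0, t != 0 & ev r * ev p = ev t * ev q].
  move=> p0 q0; have [r [t [rt rtE]]] := skew_ore p0 q0; exists r, t.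
  have nil P Q : P != 0 -> Q != 0 -> ev P * ev Q = 0 -> False.
    by move=> P0 Q0 E0; have := mul_neq0 P Q 0 P0 Q0;
      rewrite skew_eval0 => /(_ E0)/eqP.
  have [r0|r0] := eqVneq r 0.
    case: rt => [|t0]; first by rewrite r0 eqxx.
    by case: (nil t q t0 q0); rewrite -rtE r0 skew_eval0 mul0r.
  split=> //; apply/eqP => t0.
  by case: (nil r p r0 p0); rewrite rtE t0 skew_eval0 mul0r.
pose Q := [set u | E u /\ exists p q, p != 0 /\ ev p *: u = ev q *: u0].
have QK c u : Q u -> Q (jK c *: u).
  move=> [Eu [p [q [p0 pq]]]]; split; first exact: submoduleZ.
  have [->|c0] := eqVneq c 0.
    exists 1, 0; rewrite oner_neq0; split=> //.
    by rewrite skew_eval0 rmorph0 !scale0r scaler0.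
  (* The coefficients of p(x) c^-1, which cancels the scalar [c] applied to [u]. *)
  exists (\poly_(l < size p) (p`_l * iter l sigma c^-1)), q; split.
    by rewrite -size_poly_eq0 skew_scaled_size ?invr_eq0 // size_poly_eq0.
  by rewrite -(skew_evalMj xK) scalerA -mulrA -rmorphM mulVf // rmorph1 mulr1.
have sQ : submodule Q.
  apply: sl_submodule => [|u v|//|a u|u|u].
  - split; first exact: submodule0.
    exists 1, 0; rewrite oner_neq0; split=> //.
    by rewrite skew_eval0 scale0r scaler0.
  - move=> [Eu [p [q [p0 pq]]]] [Ev [p' [q' [p'0 pq']]]].
    split; first exact: submoduleD.
    have [r [t [r0 t0 rt]]] := ore p p' p0 p'0.
    have [d dE] := skew_eval_mul r p; have [h hE] := skew_eval_mul r q.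
    have [h' hE'] := skew_eval_mul t q'.
    exists d, (h + h'); split; first exact: mul_neq0 dE.
    rewrite scalerDr -dE skew_evalD scalerDl -hE -hE' -!scalerA pq; congr (_ + _).
    by rewrite scalerA rt -scalerA pq'.
  - by move=> Qu; rewrite (EA a _ Qu.1); exact: QK.
  - move=> [Eu [p [q [p0 pq]]]]; split; first exact: submoduleZ.
    exists (map_poly sigma p), (twist sigma q); split; first by rewrite map_poly_eq0.
    rewrite scalerA -skew_evalMX mulrC -/(twist sigma p).
    by rewrite !(skew_eval_twist xK) -!scalerA pq.
  move=> [Eu [p [q [p0 pq]]]]; split; first exact: submoduleZ.
  exists (p * 'X), q; split; first by rewrite mulf_neq0 ?polyX_eq0.
  by rewrite skew_evalMX scalerA -mulrA xy mulr1.
pose M : lmodType S := submod_of sQ.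
have Qu0 : Q u0 by split=> //; exists 1, 1; rewrite oner_neq0.
pose e0 : M := submod_elt sQ Qu0.
have e0n : e0 <> 0 by move=> /(congr1 val).
have evM p (m : M) : val (ev p *: m) = ev p *: val m by [].
have EM (m : M) : E (val m) by have [] := submod_valP m.
have injM p (m : M) : p != 0 -> ev p *: m = 0 -> m = 0.
  move=> p0 /(congr1 val); rewrite evM => /(Einj p _ p0 (EM m)) m0.
  by apply: val_inj; rewrite m0.
have fracM (m : M) : exists p q, p != 0 /\ ev p *: m = ev q *: e0.
  have [_ [p [q [p0 pq]]]] := submod_valP m; exists p, q; split=> //.
  by apply: val_inj; rewrite !evM.
have Mdiv : division_endomorphism_ring M.
  split=> [/(congr1 (@^~ e0)) //|h h0].
  have hZ r m : h (r *: m) = r *: h m by exact: linearZ.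
  have he0 : h e0 <> 0.
    move=> he0; apply: h0; apply/funext => m /=; have [p [q [p0 pq]]] := fracM m.
    by apply: (injM p) => //; rewrite -hZ pq hZ he0 scaler0.
  have h_inj m : h m = 0 -> m = 0.
    move=> hm; have [p [q [p0 pq]]] := fracM m; apply: (injM p) => //.
    have [q0|q0] := eqVneq q 0; first by rewrite pq q0 skew_eval0 scale0r.
    case: he0; apply: (injM q) => //.
    by rewrite -hZ -pq hZ hm scaler0.
  apply: linear_inverse => [m m' hm|m].
    by apply/eqP; rewrite -subr_eq0; apply/eqP/h_inj; rewrite linearB /= hm subrr.
  have [p [q [p0 pq]]] := fracM (h e0); have [r [s [r0 rs]]] := fracM m.
  have q0 : q != 0.
    by apply: contra_notN he0 => /eqP q0; apply: (injM p) => //;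
      rewrite pq q0 skew_eval0 scale0r.
  have [s0|s0] := eqVneq s 0.
    exists 0; rewrite linear0; apply/esym; apply: (injM r) => //.
    by rewrite rs s0 skew_eval0 scale0r.
  (* With h e0 = p^-1 q e0 and m = r^-1 s e0, the Ore relation t q = z s gives the preimage u = (z
     r)^-1 t p e0: applying z r to h u gives t q e0 = z s e0 = z r m. Divisibility of [E] provides
     u. *)
  have [t [z [t0 z0 tz]]] := ore q s q0 s0.
  have [d dE] := skew_eval_mul z r; have [g gE] := skew_eval_mul t p.
  have d0 : d != 0 by exact: mul_neq0 dE.
  have [u Eu uE] := Esurj d (ev g *: u0) d0 (submoduleZ _ sE Eu0).
  have Qu : Q u by split=> //; exists d, g.
  have uE' : ev d *: (submod_elt sQ Qu : M) = ev g *: e0.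
    by apply: val_inj; rewrite !evM.
  exists (submod_elt sQ Qu).
  apply/eqP; rewrite -subr_eq0; apply/eqP; apply: (injM d) => //.
  rewrite scalerBr -hZ uE' hZ -gE -dE -!scalerA pq rs !scalerA tz.
  by rewrite subrr.
(* Were [M] simple, it would have a basis of vectors fixed by [x]; but [x - 1] is injective on [M],
   so these vectors would all be 0. *)
have [d [w [w_span w_free xw]]] := fixed_basis (simple_finite_length (CSL M I Mdiv)).
case: d w w_span w_free xw => [|d] w w_span w_free xw.
  by have [c] := (w_span e0).1 I; rewrite /comb big_ord0.
have w0 : w ord0 = 0.
  apply: (injM ('X - 1)); first by rewrite -[1]/(1%:P) polyXsubC_eq0.
  by rewrite skew_evalD skew_evalN skew_eval1 -['X]mul1r skew_evalMX skew_eval1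
    mul1r scalerBl scale1r xw subrr.
have w_delta : comb jK w (fun l => (l == ord0)%:R) = 0 by rewrite comb_delta.
by have /eqP := w_free _ w_delta ord0; rewrite /= oner_eq0.
Qed.

End SkewModules.

(** * The ring *)

(* Every u is a family of k-linear maps A -> K indexed by the integers, and the
   ring A (x)_k K[x, x^-1; sigma] is realized by the operators on such families
   generated by K, A and the twisted shift x; the product is the opposite of
   composition, so that right modules over the ring are modules over operators. *)
Section OperatorRing.
Variables (k : finFieldType) (A : falgType k) (FF : frobenius_field k).
Local Notation K := (ff_field FF).
Local Notation iota := (@ff_inj _ FF).
Local Notation sigma := (@ff_frob _ FF).
Local Notation sigmaV := (@ff_frob_inv _ FF).
Local Notation sc := (@scalar_op k A).

Definition linear_seq : set (A -> int -> K) :=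
  [set u | forall (c : k) a b m, u (c *: a + b) m = iota c * u a m + u b m].

Fact linear_seq_zmod_closed : zmod_closed [in linear_seq].
Proof.
split=> [|u v /set_mem Hu /set_mem Hv]; apply/mem_set => c a b m.
  by rewrite mulr0 addr0.
by rewrite -![(u - v) _ _]/(u _ _ - v _ _) Hu Hv; ring.
Qed.

Definition seq_module := {u : A -> int -> K | u \in linear_seq}.

HB.instance Definition _ := SubChoice.on seq_module.
HB.instance Definition _ :=
  GRing.SubChoice_isSubZmodule.Build (A -> int -> K) [in linear_seq]
    seq_module linear_seq_zmod_closed.

Definition seq_val (u : seq_module) : A -> int -> K := val u.

Lemma seq_val_inj u v : (forall a m, seq_val u a m = seq_val v a m) -> u = v.
Proof. by move=> uv; apply: val_inj; apply/funext => a; apply/funext => m;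
  exact: uv. Qed.

Lemma seq_val_linear u c a b m :
  seq_val u (c *: a + b) m = iota c * seq_val u a m + seq_val u b m.
Proof. by have := set_mem (valP u); exact. Qed.

Lemma seq_valD u v a m : seq_val (u + v) a m = seq_val u a m + seq_val v a m.
Proof. by []. Qed.

Lemma seq_val0 a m : seq_val 0 a m = 0.
Proof. by []. Qed.

Definition seq_elt (u : A -> int -> K) (Hu : linear_seq u) : seq_module :=
  Sub u (mem_set Hu).

Lemma seq_eltK u (Hu : linear_seq u) a m : seq_val (seq_elt Hu) a m = u a m.
Proof. by []. Qed.

Fact op_alg_proof a u : linear_seq (fun b m => seq_val u (a * b) m).
Proof. by move=> c b d m; rewrite mulrDr -scalerAr seq_val_linear. Qed.

Definition op_alg (a : A) (u : seq_module) : seq_module := seq_elt (op_alg_proof a u).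

Fact op_field_proof c u : linear_seq (fun b m => c * seq_val u b m).
Proof. by move=> d a b m; rewrite seq_val_linear mulrDr mulrCA. Qed.

Definition op_field (c : K) (u : seq_module) : seq_module := seq_elt
  (op_field_proof c u).

Fact op_shift_proof u : linear_seq (fun b m => sigma (seq_val u b (m - 1))).
Proof. by move=> c b d m; rewrite seq_val_linear rmorphD rmorphM ff_frob_inj. Qed.

Definition op_shift (u : seq_module) : seq_module := seq_elt (op_shift_proof u).

Lemma ff_frob_invD c d : sigmaV (c + d) = sigmaV c + sigmaV d.
Proof. by apply: (fmorph_inj sigma); rewrite rmorphD !ff_frobKV. Qed.

Lemma ff_frob_invM c d : sigmaV (c * d) = sigmaV c * sigmaV d.
Proof. by apply: (fmorph_inj sigma); rewrite rmorphM !ff_frobKV. Qed.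

Lemma ff_frob_inv_inj c : sigmaV (iota c) = iota c.
Proof. by apply: (fmorph_inj sigma); rewrite ff_frobKV ff_frob_inj. Qed.

Fact op_unshift_proof u : linear_seq (fun b m => sigmaV (seq_val u b (m + 1))).
Proof. by move=> c b d m; rewrite seq_val_linear ff_frob_invD ff_frob_invM
  ff_frob_inv_inj. Qed.

Definition op_unshift (u : seq_module) : seq_module := seq_elt (op_unshift_proof u).

(** Zero, the identity and negation need no constructor: they come from the scalars 0, 1 and -1. *)
Inductive operator : set (seq_module -> seq_module) :=
| operator_alg a : operator (op_alg a)
| operator_field c : operator (op_field c)
| operator_shift : operator op_shift
| operator_unshift : operator op_unshift
| operatorD r s : operator r -> operator s -> operator (r + s)
| operator_comp r s : operator r -> operator s -> operator (r \o s).

Lemma operator_additive r u v : operator r -> r (u + v) = r u + r v.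
Proof.
move=> r_op; elim: r_op u v => {r} [a|c|||r s _ IHr _ IHs|r s _ IHr _ IHs] u v.
- by apply: seq_val_inj => b m; rewrite seq_valD !seq_eltK seq_valD.
- by apply: seq_val_inj => a m; rewrite seq_valD !seq_eltK seq_valD mulrDr.
- by apply: seq_val_inj => a m; rewrite seq_valD !seq_eltK seq_valD rmorphD.
- by apply: seq_val_inj => a m; rewrite seq_valD !seq_eltK seq_valD ff_frob_invD.
- by rewrite -![(r + s) _]/(r _ + s _) IHr IHs addrACA.
by rewrite /= IHs IHr.
Qed.

Fact operator_zmod_closed : zmod_closed [in operator].
Proof.
split=> [|r s /set_mem r_op /set_mem s_op]; apply/mem_set.
  rewrite (_ : 0 = op_field 0); first exact: operator_field.
  by apply/funext => u; apply: seq_val_inj => a m; rewrite seq_eltK mul0r.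
rewrite (_ : r - s = r + (op_field (-1) \o s)).
  by apply: operatorD => //; apply: operator_comp => //; exact: operator_field.
apply/funext => u; apply: seq_val_inj => a m.
rewrite -[LHS]/(seq_val (r u) a m - seq_val (s u) a m).
by rewrite -[RHS]/(seq_val (r u) a m + (-1) * seq_val (s u) a m) mulN1r.
Qed.

Definition operator_ring := {r : seq_module -> seq_module | r \in operator}.

HB.instance Definition _ := SubChoice.on operator_ring.
HB.instance Definition _ :=
  GRing.SubChoice_isSubZmodule.Build (seq_module -> seq_module) [in operator]
    operator_ring operator_zmod_closed.

Definition op_elt r (r_op : operator r) : operator_ring := Sub r (mem_set r_op).

Lemma op_valP (r : operator_ring) : operator (val r).
Proof. exact/set_mem/(valP r). Qed.

Fact op_one_proof : operator idfun.
Proof.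
rewrite (_ : idfun = op_field 1); first exact: operator_field.
by apply/funext => u; apply: seq_val_inj => a m; rewrite seq_eltK mul1r.
Qed.

Definition op_one : operator_ring := op_elt op_one_proof.

Definition op_mul (r s : operator_ring) : operator_ring :=
  op_elt (operator_comp (op_valP s) (op_valP r)).

Fact op_mulA : associative op_mul.
Proof. by move=> r s t; apply: val_inj. Qed.

Fact op_mul1 : left_id op_one op_mul.
Proof. by move=> r; apply: val_inj. Qed.

Fact op_mulr1 : right_id op_one op_mul.
Proof. by move=> r; apply: val_inj. Qed.

Fact op_mulDl : left_distributive op_mul +%R.
Proof.
move=> r s t; apply: val_inj; apply/funext => u /=.
exact: operator_additive (op_valP t).
Qed.

Fact op_mulDr : right_distributive op_mul +%R.
Proof. by move=> r s t; apply: val_inj. Qed.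

(** A coordinate form of [A] that is nonzero at 1, repeated at every integer, is a nonzero element
    on which the identity acts. *)
Fact op_one_neq0 : op_one != 0.
Proof.
have [s vs] : exists s, coord (vbasis {:A}) s 1 != 0.
  apply/existsP; apply: contraT; rewrite negb_exists => /forallP c0.
  case/eqP: (oner_neq0 A); rewrite (coord_vbasis (memvf 1)) big1 // => s _.
  by have /negPn/eqP-> := c0 s; rewrite scale0r.
have lin : linear_seq (fun a _ => iota (coord (vbasis {:A}) s a)).
  by move=> c a b m; rewrite linearD linearZ rmorphD rmorphM.
apply/eqP => /(congr1 (fun r => seq_val (val r (seq_elt lin)) 1 0)).
by rewrite /= seq_eltK => /eqP; rewrite fmorph_eq0 (negPf vs).
Qed.

HB.instance Definition _ := GRing.Zmodule_isNzRing.Build operator_ring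
  op_mulA op_mul1 op_mulr1 op_mulDl op_mulDr op_one_neq0.

Local Notation R := operator_ring.

Definition op_scale (r : R^c) (u : seq_module) : seq_module := val (r : R) u.

Definition op_module : Type := seq_module.

HB.instance Definition _ := GRing.Zmodule.on op_module.

Fact op_scaleA (r s : R^c) u : op_scale r (op_scale s u) = op_scale (r * s) u.
Proof. by []. Qed.

Fact op_scale1 : left_id 1 op_scale.
Proof. by []. Qed.

Fact op_scaleDr : right_distributive op_scale +%R.
Proof. by move=> r u v; exact: operator_additive (op_valP r). Qed.

Fact op_scaleDl u (r s : R^c) : op_scale (r + s) u = op_scale r u + op_scale s u.
Proof. by []. Qed.

HB.instance Definition _ := GRing.Zmodule_isLmodule.Build R^c op_module
  op_scaleA op_scale1 op_scaleDr op_scaleDl.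

Definition ring_alg (a : A^c) : R^c := op_elt (operator_alg a).
Definition ring_field (c : K) : R^c := op_elt (operator_field c).
Definition ring_x : R^c := op_elt operator_shift.
Definition ring_y : R^c := op_elt operator_unshift.

Lemma op_ext (r s : R^c) :
  (forall u a m, seq_val (val (r : R) u) a m = seq_val (val (s : R) u) a m) -> r = s.
Proof. by move=> rs; apply: val_inj; apply/funext => u; apply: seq_val_inj. Qed.

Lemma seq_valDl u a b m : seq_val u (a + b) m = seq_val u a m + seq_val u b m.
Proof. by have := seq_val_linear u 1 a b m; rewrite scale1r rmorph1 mul1r. Qed.

Lemma seq_val_at0 u m : seq_val u 0 m = 0.
Proof. by apply: (addrI (seq_val u 0 m)); rewrite -seq_valDl !addr0. Qed.

Lemma seq_valZl u c a m : seq_val u (c *: a) m = iota c * seq_val u a m.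
Proof. by rewrite -[c *: a]addr0 seq_val_linear seq_val_at0 addr0. Qed.

Fact ring_alg_additive : zmod_morphism ring_alg.
Proof.
move=> a b; apply: op_ext => u c m.
change (seq_val u ((a - b : A) * c) m =
  seq_val u ((a : A) * c) m - seq_val u ((b : A) * c) m).
by rewrite mulrBl -scaleN1r addrC seq_val_linear rmorphN1 mulN1r addrC.
Qed.

Fact ring_alg_multiplicative : monoid_morphism ring_alg.
Proof.
split=> [|a b]; apply: op_ext => u c m.
  by change (seq_val u ((1 : A) * c) m = seq_val u c m); rewrite mul1r.
change (seq_val u ((b : A) * (a : A) * c) m = seq_val u ((b : A) * ((a : A) * c)) m).
by rewrite mulrA.
Qed.

HB.instance Definition _ :=
  GRing.isZmodMorphism.Build A^c R^c ring_alg ring_alg_additive.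
HB.instance Definition _ :=
  GRing.isMonoidMorphism.Build A^c R^c ring_alg ring_alg_multiplicative.

Fact ring_field_additive : zmod_morphism ring_field.
Proof.
move=> c d; apply: op_ext => u a m.
change ((c - d) * seq_val u a m = c * seq_val u a m - d * seq_val u a m).
exact: mulrBl.
Qed.

Fact ring_field_multiplicative : monoid_morphism ring_field.
Proof.
split=> [|c d]; apply: op_ext => u a m.
  by change (1 * seq_val u a m = seq_val u a m); rewrite mul1r.
change (c * d * seq_val u a m = c * (d * seq_val u a m)).
by rewrite mulrA.
Qed.

HB.instance Definition _ :=
  GRing.isZmodMorphism.Build K R^c ring_field ring_field_additive.
HB.instance Definition _ :=
  GRing.isMonoidMorphism.Build K R^c ring_field ring_field_multiplicative.

Lemma ring_op_ind (P : R -> Prop) : (forall a, P (ring_alg a)) ->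
  (forall c, P (ring_field c)) -> P ring_x -> P ring_y ->
  (forall r s, P r -> P s -> P (r + s)) -> (forall r s, P r -> P s -> P (s * r)) ->
  forall r, P r.
Proof.
move=> PA PK Px Py PD PM r; suff H : forall T, operator T -> forall s : R, val s
  = T -> P s.
  exact: H (op_valP r) _ erefl.
move=> T; elim=> {r T} [a|c|||r t r_op IHr t_op IHt|r t r_op IHr t_op IHt] s sE.
- by rewrite (_ : s = ring_alg a) //; exact: val_inj.
- by rewrite (_ : s = ring_field c) //; exact: val_inj.
- by rewrite (_ : s = ring_x) //; exact: val_inj.
- by rewrite (_ : s = ring_y) //; exact: val_inj.
- rewrite (_ : s = op_elt r_op + op_elt t_op); last exact: val_inj.
  by apply: PD; [exact: IHr | exact: IHt].
rewrite (_ : s = op_elt t_op * op_elt r_op); last exact: val_inj.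
by apply: PM; [exact: IHr | exact: IHt].
Qed.

Lemma ring_x_field c : ring_x * ring_field c = ring_field (sigma c) * ring_x.
Proof.
apply: op_ext => u a m.
change (sigma (c * seq_val u a (m - 1)) = sigma c * sigma (seq_val u a (m - 1))).
exact: rmorphM.
Qed.

Lemma ring_xy : ring_x * ring_y = 1.
Proof.
apply: op_ext => u a m.
change (sigma (sigmaV (seq_val u a (m - 1 + 1))) = seq_val u a m).
by rewrite ff_frobKV subrK.
Qed.

Lemma ring_yx : ring_y * ring_x = 1.
Proof.
apply: op_ext => u a m.
change (sigmaV (sigma (seq_val u a (m + 1 - 1))) = seq_val u a m).
by rewrite ff_frobK addrK.
Qed.

Lemma ring_x_alg a : ring_x * ring_alg a = ring_alg a * ring_x.
Proof. by apply: op_ext => u b m. Qed.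

Lemma ring_field_alg c a : ring_field c * ring_alg a = ring_alg a * ring_field c.
Proof. by apply: op_ext => u b m. Qed.

Lemma ring_scalar c : ring_alg (sc c) = ring_field (iota c).
Proof.
apply: op_ext => u a m.
change (seq_val u ((c%:A : A) * a) m = iota c * seq_val u a m).
by rewrite mulr_algl seq_valZl.
Qed.

Lemma ring_ind_op (P : R^c -> Prop) : (forall a, P (ring_alg a)) ->
  (forall c, P (ring_field c)) -> P ring_x -> P ring_y ->
  (forall r s : R^c, P r -> P s -> P (r + s)) ->
  (forall r s : R^c, P r -> P s -> P (r * s)) -> forall r, P r.
Proof. by move=> PA PK Px Py PD PM; exact: (@ring_op_ind P). Qed.

Definition operator_skew_laurent : skew_laurent A FF R^c :=
  SkewLaurent ring_x_field ring_xy ring_yx ring_x_alg ring_field_alg ring_scalar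
    ring_ind_op.

End OperatorRing.

(** A [k]-basis of [A] generates the ring over the skew Laurent polynomials. The map [jA] is only
    asked to have an image closed under products, so that the lemma covers both [R], where it
    reverses products, and [R^c]. *)
Lemma skew_span_ring (k : fieldType) (A : falgType k) (K : fieldType)
    (iota : {rmorphism k -> K}) (S : nzRingType) (j : {rmorphism K -> S}) (x y : S)
    (jA : A -> S) :
  (forall a b, jA (a + b) = jA a + jA b) -> jA 1 = 1 ->
  (forall c a, jA (c *: a) = j (iota c) * jA a) ->
  (forall a b, exists c, jA a * jA b = jA c) ->
  (forall c a, j c * jA a = jA a * j c) ->
  (forall a, x * jA a = jA a * x) -> (forall a, y * jA a = jA a * y) ->
  (forall P : S -> Prop, P 1 -> (forall a v, P v -> P (jA a * v)) ->
    (forall c v, P v -> P (j c * v)) -> (forall v, P v -> P (x * v)) ->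
    (forall v, P v -> P (y * v)) -> (forall u v, P u -> P v -> P (u + v)) ->
    forall v, P v) ->
  exists bs : seq S^o, forall v, skew_span j x y bs v.
Proof.
move=> jAD jA1 jAZ jAM jAK jAx jAy S_ind.
pose bs : seq S^o := [seq jA b | b <- vbasis {:A}].
have [N0 ND NK Nx Ny] := skew_span_stable j x y bs.
have jA0 : jA 0 = 0 by rewrite -(scale0r (0 : A)) jAZ !rmorph0 mul0r.
have bsA a : skew_span j x y bs (jA a).
  rewrite (coord_vbasis (memvf a)) (big_morph jA jAD jA0).
  elim/big_ind: _ => [||l _]; [exact: N0 | exact: ND |].
  rewrite jAZ; apply: (NK (iota _)); apply: mem_skew_span; apply: map_f.
  by apply: mem_nth; rewrite size_tuple.
exists bs; apply: S_ind => [|a v Hv||||];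
  [by rewrite -jA1 | | exact: NK | exact: Nx | exact: Ny | exact: ND].
(* The elements that [jA a] sends into the span form a stable set, since [jA a] commutes with [K],
   [x] and [y], and this set contains the generators. *)
apply: (Hv [set v | skew_span j x y bs (jA a * v)]) => [|b /mapP[b' _ ->] /=].
  split=> /= [|u w Hu Hw|c w Hw|w Hw|w Hw].
  - by rewrite mulr0.
  - by rewrite mulrDr; exact: ND.
  - by rewrite [c in _ * c](_ : _ = j c * w) // mulrA -jAK -mulrA; exact: NK.
  - by rewrite [X in _ * X](_ : _ = x * w) // mulrA -jAx -mulrA; exact: Nx.
  by rewrite [X in _ * X](_ : _ = y * w) // mulrA -jAy -mulrA; exact: Ny.
by have [c ->] := jAM a b'.
Qed.

(** * The operator ring is noetherian on both sides *)

Section OperatorRingProperties.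
Variables (k : finFieldType) (A : falgType k) (FF : frobenius_field k).
Local Notation K := (ff_field FF).
Local Notation iota := (@ff_inj _ FF).
Local Notation sigma := (@ff_frob _ FF).
Local Notation sc := (@scalar_op k A).
Local Notation R := (operator_ring A FF).
Local Notation SL := (operator_skew_laurent A FF).

(** Since [K] is commutative, the scalars form a ring morphism into [R] as well as into [R^c]. *)
Definition ring_field_left (c : K) : R := ring_field A c.

Fact ring_field_left_additive : zmod_morphism ring_field_left.
Proof. exact: ring_field_additive. Qed.

Fact ring_field_left_multiplicative : monoid_morphism ring_field_left.
Proof.
split=> [|c d]; first exact: (rmorph1 (@ring_field _ A FF)).
by rewrite mulrC; exact: (rmorphM (@ring_field _ A FF)).
Qed.

HB.instance Definition _ :=
  GRing.isZmodMorphism.Build K R ring_field_left ring_field_left_additive.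
HB.instance Definition _ :=
  GRing.isMonoidMorphism.Build K R ring_field_left ring_field_left_multiplicative.

Lemma operator_ring_noetherian : noetherian_ring R.
Proof.
split.
  (* In R itself the Frobenius relation is satisfied by y instead of x. *)
  have yK c : (ring_y A FF : R) * ring_field_left c = ring_field_left (sigma c) *
    (ring_y A FF : R).
    exact: esym (sl_field_y SL c).
  have yx : (ring_y A FF : R) * (ring_x A FF : R) = 1 := ring_xy A FF.
  have xy : (ring_x A FF : R) * (ring_y A FF : R) = 1 := ring_yx A FF.
  have [||||||||bs bsP] := @skew_span_ring _ A _ iota R ring_field_left (ring_y A FF)
      (ring_x A FF) (@ring_alg _ A FF).
  - by move=> a b; exact: (raddfD (@ring_alg _ A FF)).
  - exact: (rmorph1 (@ring_alg _ A FF)).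
  - move=> c a; rewrite -mulr_algl.
    transitivity ((@ring_alg _ A FF (a : A^c) : R^c) * (@ring_alg _ A FF (sc c))).
      exact: (rmorphM (@ring_alg _ A FF) (a : A^c) (sc c)).
    by rewrite ring_scalar.
  - by move=> a b; exists (a * b);
    exact: esym (rmorphM (@ring_alg _ A FF) (b : A^c) (a : A^c)).
  - by move=> c a; exact: esym (ring_field_alg c a).
  - by move=> a; exact: esym (sl_alg_y SL a).
  - by move=> a; exact: esym (@ring_x_alg _ A FF a).
  (* Induction on [v] for all right factors [w] satisfying [P], to be used at [w = 1]: a product
     then acts one factor at a time. *)
  - move=> P P1 PA PK Px Py PD v; rewrite -[v]mulr1.
    move: P1; move: 1 => w; move: v w.
    apply: ring_op_ind => //; first by move=> r s Hr Hs w Pw; rewrite mulrDl;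
      apply: PD; [exact: Hr | exact: Hs].
    by move=> r s Hr Hs w Pw; rewrite -mulrA; apply: Hs; exact: Hr.
  exact: (skew_noetherian yK yx xy bsP).
have [||||||||bs bsP] := @skew_span_ring _ A _ iota R^c (@ring_field _ A FF)
  (ring_x A FF)
    (ring_y A FF) (@ring_alg _ A FF).
- by move=> a b; exact: (raddfD (@ring_alg _ A FF)).
- exact: (rmorph1 (@ring_alg _ A FF)).
- move=> c a; rewrite -mulr_algr.
  transitivity (@ring_alg _ A FF (sc c) * (@ring_alg _ A FF (a : A^c) : R^c)).
    exact: (rmorphM (@ring_alg _ A FF) (sc c) (a : A^c)).
  by rewrite ring_scalar.
- by move=> a b; exists (b * a);
  exact: esym (rmorphM (@ring_alg _ A FF) (a : A^c) (b : A^c)).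
- by move=> c a; exact: ring_field_alg.
- by move=> a; exact: ring_x_alg.
- by move=> a; exact: (sl_alg_y SL a).
- move=> P P1 PA PK Px Py PD v; rewrite -[v]mulr1.
  move: P1; move: 1 => w; move: v w.
  apply: (sl_ind (s := SL) (P := fun v : R^c => forall w, P w -> P (v * w))) =>
    //; first by move=> r s Hr Hs w Pw; rewrite mulrDl; apply: PD;
      [exact: Hr | exact: Hs].
  by move=> r s Hr Hs w Pw; rewrite -mulrA; apply: Hr; exact: Hs.
exact: (skew_noetherian (@ring_x_field _ A FF) (ring_xy A FF) (ring_yx A FF) bsP).
Qed.

End OperatorRingProperties.

(** * Scalar extensions and Laurent series inside the operator module *)

Section Realization.
Variables (k : finFieldType) (A : falgType k) (FF : frobenius_field k).
Local Notation K := (ff_field FF).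
Local Notation iota := (@ff_inj _ FF).
Local Notation sigma := (@ff_frob _ FF).
Local Notation sc := (@scalar_op k A).
Local Notation R := (operator_ring A FF).
Local Notation SL := (operator_skew_laurent A FF).
Local Notation jK := (sl_field SL).
Local Notation jA := (sl_alg SL).
Local Notation x := (sl_x SL).
Local Notation y := (sl_y SL).
Local Notation U := (op_module A FF : lmodType R^c).
Local Notation ev := (skew_eval jK x).

(** A vector [v] goes to the d families sending [a] to a coordinate of [a *: v], constant in the
    integer index. Constant families with values in [k] are fixed by the twisted shift, and
    evaluation at [a = 1] recovers the coordinates, whence freeness over [K]. *)
Lemma operator_scalar_extension (X : lmodType A^c) d (w : 'I_d -> X) :
  spans sc w setT -> free_family sc w ->
  exists (Y : lmodType R^c) (eta : X -> Y), scalar_extension SL w eta.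
Proof.
move=> w_span w_free.
have [co coE] := choice (fun v => (w_span v).1 I).
have coD u v l : co (u + v) l = co u l + co v l.
  by apply: (free_family_inj w_free (c := co (u + v)) (c' := fun l => _));
    rewrite -coE combD -!coE.
have coZ c u l : co (sc c *: u) l = c * co u l.
  by apply: (free_family_inj w_free (c' := fun l => _)); rewrite -coE combZ -coE.
have cow i l : co (w i) l = (l == i)%:R.
  by apply: (free_family_inj w_free (c' := fun l => (l == i)%:R));
    rewrite -coE comb_delta.
have lin v l : linear_seq (FF := FF) (fun (a : A) (_ : int) => iota (co ((a :
  A^c) *: v) l)).
  move=> c a b m; rewrite [X in co X l](_ : _ = sc c *: ((a : A^c) *: v) + (b :
    A^c) *: v).
    by rewrite coD coZ rmorphD rmorphM.
  rewrite scalerA -scalerDl; congr (_ *: v).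
  by change (c *: a + b = (a : A) * c%:A + b); rewrite mulr_algr.
pose eta v : 'I_d -> U := fun l => seq_elt (lin v l).
apply: (@scalar_extension_sub _ _ _ _ SL X d w ('I_d -> U : lmodType R^c) eta) => //.
- move=> u v; apply/funext => l; apply: seq_val_inj => a m.
  change (iota (co ((a : A^c) *: (u + v)) l) =
    iota (co ((a : A^c) *: u) l) + iota (co ((a : A^c) *: v) l)).
  by rewrite scalerDr coD rmorphD.
- move=> b u; apply/funext => l; apply: seq_val_inj => a m.
  change (iota (co ((a : A^c) *: (b *: u)) l) = iota (co (((b : A) * a : A^c) *:
    u) l)).
  by rewrite scalerA.
- move=> u; apply/funext => l; apply: seq_val_inj => a m.
  change (sigma (iota (co ((a : A^c) *: u) l)) = iota (co ((a : A^c) *: u) l)).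
  exact: ff_frob_inj.
move=> c c0 l.
pose at1 (z : 'I_d -> U) : K := seq_val (z l) 1 0.
have at1D z z' : at1 (z + z') = at1 z + at1 z' by [].
have at1_0 : at1 0 = 0 by [].
have := congr1 at1 c0; rewrite at1_0 (big_morph at1 at1D at1_0).
under eq_bigr => i _.
  rewrite [at1 _](_ : _ = c i * iota (co (((1 : A) : A^c) *: w i) l)) //.
  rewrite [X in co X](_ : _ = w i); last exact: scale1r.
  rewrite cow.
  over.
rewrite (bigD1 l) //= eqxx rmorph1 mulr1 big1 ?addr0 // => i.
by rewrite eq_sym => /negPf->; rewrite rmorph0 mulr0.
Qed.

Lemma seq_val_sum I (r : seq I) (P : pred I) (G : I -> U) a m :
  seq_val (\sum_(i <- r | P i) G i) a m = \sum_(i <- r | P i) seq_val (G i) a m.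
Proof. exact: (big_morph (fun u : U => seq_val u a m)). Qed.

Lemma seq_val_xX l (u : U) a m :
  seq_val (x ^+ l *: u : U) a m = iter l sigma (seq_val u a (m - l%:Z)).
Proof.
elim: l m => [|l IHl] m; first by rewrite expr0 scale1r subr0.
rewrite exprS -scalerA iterS.
change (sigma (seq_val (x ^+ l *: u : U) a (m - 1)) =
  sigma (iter l sigma (seq_val u a (m - l.+1%:Z)))).
by rewrite IHl; congr (sigma (iter l sigma (seq_val u a _))); lia.
Qed.

Lemma seq_val_ev p (u : U) a m : seq_val (ev p *: u : U) a m =
  \sum_(l < size p) p`_l * iter l sigma (seq_val u a (m - l%:Z)).
Proof.
rewrite skew_eval_sum scaler_suml seq_val_sum; apply: eq_bigr => l _.
rewrite -seq_val_xX -scalerA.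
by change (p`_l * seq_val (x ^+ l *: u : U) a m = p`_l * seq_val (x ^+ l *: u :
  U) a m).
Qed.

(** Course-of-values recursion: [D m] is a table whose entries below [m] are final. *)
Lemma strong_recursion (T : Type) (t0 : T) (step : nat -> (nat -> T) -> T) :
  (forall m g g', (forall i, (i < m)%N -> g i = g' i) -> step m g = step m g') ->
  exists g, forall m, g m = step m g.
Proof.
move=> step_ext.
pose D := fix D m := if m is m'.+1 then
  fun i => if i == m' then step m' (D m') else D m' i else fun _ : nat => t0.
have DE m i : (i < m)%N -> D m i = D i.+1 i.
  elim: m => // m IHm; rewrite ltnS leq_eqVlt => /predU1P[->//|im].
  by rewrite -IHm //= ltn_eqF.
exists (fun m => D m.+1 m) => m; rewrite /= eqxx; apply: step_ext => i im.
exact: DE.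
Qed.

Section Laurent.
Variables (n : nat) (f : {lrmorphism A -> {ffun 'I_n -> k^o} | *:%R}) (i0 : 'I_n).
Local Notation chi := (char_at f).

(* The copy of the skew Laurent series field K((x; sigma)) on which A acts
   through its character of index i0. *)
Definition laurent : set U := [set u | exists s, forall a m,
  ((m < s)%R -> seq_val u a m = 0) /\
  seq_val u a m = iota (chi i0 a) * seq_val u 1 m].

Fact laurent_elt_linear (e : int -> K) :
  linear_seq (FF := FF) (fun (a : A) m => iota (chi i0 a) * e m).
Proof. by move=> c a b m; rewrite char_atD char_atZ rmorphD rmorphM mulrDl mulrA. Qed.

Definition laurent_elt e : U := seq_elt (laurent_elt_linear e).

Lemma laurent_eltE e a m : seq_val (laurent_elt e) a m = iota (chi i0 a) * e m.
Proof. by []. Qed.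

Lemma laurent_eltP e s : (forall m, (m < s)%R -> e m = 0) -> laurent (laurent_elt e).
Proof.
move=> e0; exists s => a m; rewrite !laurent_eltE char_at1 rmorph1 mul1r.
by split=> // /e0->; rewrite mulr0.
Qed.

Lemma laurent_alg a u : laurent u -> jA a *: u = jK (iota (chi i0 a)) *: u.
Proof.
move=> [s us]; apply: seq_val_inj => b m.
change (seq_val u ((a : A) * b) m = iota (chi i0 a) * seq_val u b m).
by rewrite (us _ _).2 (us b m).2 char_atM rmorphM mulrA.
Qed.

Lemma laurent_submodule : submodule laurent.
Proof.
apply: (sl_submodule (SL := SL)).
- by exists 0 => a m; rewrite seq_val0 mulr0.
- move=> u v [s us] [t vt]; exists (Num.min s t) => a m; split.
    rewrite Order.TotalTheory.lt_min => /andP[ms mt].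
    by rewrite [LHS]seq_valD (us a m).1 // (vt a m).1 // addr0.
  by rewrite [LHS]seq_valD (us a m).2 (vt a m).2 -mulrDr.
- move=> c u [s us]; exists s => a m.
  change (((m < s)%R -> c * seq_val u a m = 0) /\
    c * seq_val u a m = iota (chi i0 a) * (c * seq_val u 1 m)).
  by split=> [/(us a m).1->|]; rewrite ?mulr0 // mulrCA -(us a m).2.
- move=> b u /[dup] Eu [s us]; exists s => a m; rewrite laurent_alg //.
  change (((m < s)%R -> iota (chi i0 b) * seq_val u a m = 0) /\
    iota (chi i0 b) * seq_val u a m = iota (chi i0 a) * (iota (chi i0 b) *
      seq_val u 1 m)).
  by split=> [/(us a m).1->|]; rewrite ?mulr0 // mulrCA -(us a m).2.
- move=> u [s us]; exists (s + 1) => a m.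
  change (((m < s + 1)%R -> sigma (seq_val u a (m - 1)) = 0) /\
    sigma (seq_val u a (m - 1)) = iota (chi i0 a) * sigma (seq_val u 1 (m - 1))).
  rewrite -(ff_frob_inj FF (chi i0 a)) -rmorphM -(us a _).2; split=> // ms.
  by rewrite (us a _).1 ?rmorph0 //; lia.
move=> u [s us]; exists (s - 1) => a m.
change (((m < s - 1)%R -> ff_frob_inv (seq_val u a (m + 1)) = 0) /\
  ff_frob_inv (seq_val u a (m + 1)) = iota (chi i0 a) * ff_frob_inv (seq_val u 1
    (m + 1))).
rewrite -(ff_frob_inv_inj FF (chi i0 a)) -ff_frob_invM -(us a _).2; split=> // ms.
rewrite (us a _).1; last lia.
by rewrite -[X in ff_frob_inv X](rmorph0 sigma) ff_frobK.
Qed.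

Lemma poly_split_X (p : {poly K}) : p != 0 ->
  exists s q, p = q * 'X^s /\ q`_0 != 0.
Proof.
have [m] := ubnP (size p); elim: m p => // m IHm p pm p0.
have [pz|pz] := eqVneq p`_0 0; last by exists 0%N, p; rewrite expr0 mulr1.
have /factor_theorem[q qE] : root p 0 by rewrite rootE horner_coef0 pz.
rewrite subr0 in qE; have q0 : q != 0 by apply: contraNneq p0 => q0;
  rewrite qE q0 mul0r.
have [|s [r [rE r0]]] := IHm q _ q0.
  by move: pm; rewrite qE size_mulX // ltnS.
by exists s.+1, r; rewrite qE rE exprSr mulrA.
Qed.

(** Since [x] is invertible, [p] may be assumed to have a nonzero constant term. The coefficients of
    [u] then vanish one after the other, starting from its lower bound. *)
Lemma laurent_torsion_free p u : p != 0 -> laurent u -> ev p *: u = 0 -> u = 0.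
Proof.
move=> /poly_split_X[s [q [-> q0]]] Eu; rewrite skew_evalMXn -scalerA => pu.
suff xu : x ^+ s *: u = 0.
  by rewrite -[u]scale1r -(yX_xX (sl_yx SL) s) -scalerA xu scaler0.
have {Eu} : laurent (x ^+ s *: u) by apply: submoduleZ => //;
  exact: laurent_submodule.
move: (x ^+ s *: u) pu => {u} u qu [t ut].
suff H m : seq_val u 1 (t + m%:Z) = 0.
  apply: seq_val_inj => a m; rewrite seq_val0 (ut a m).2.
  have [tm|tm] := Order.TotalTheory.leP t m; last by rewrite (ut 1 m).1 ?mulr0.
  by have := H `|m - t|%N; rewrite (_ : t + _ = m) => [->|]; [rewrite mulr0 | lia].
have [b] := ubnP m; elim: b m => // b IHb m mb.
have := congr1 (fun v : U => seq_val v 1 (t + m%:Z)) qu.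
rewrite /= seq_val_ev seq_val0; have q_gt0 : (0 < size q)%N.
  by rewrite size_poly_gt0; apply: contraNneq q0 => ->; rewrite coef0.
rewrite -(prednK q_gt0) big_ord_recl big1 ?addr0 /= ?subr0 => [/eqP|l _].
  by rewrite mulf_eq0 (negPf q0) => /eqP.
rewrite /bump /= add1n; have [lm|lm] := leqP l.+1 m.
  rewrite (_ : t + m%:Z - l.+1%:Z = t + (m - l.+1)%N%:Z); last lia.
  rewrite IHb; last lia.
  by rewrite -[sigma _]/(iter l.+1 sigma 0) (_ : iter l.+1 sigma 0 = 0) ?mulr0 //;
    apply/eqP; rewrite iter_sigma_eq0.
rewrite (ut 1 _).1; last lia.
by rewrite -[sigma _]/(iter l.+1 sigma 0) (_ : iter l.+1 sigma 0 = 0) ?mulr0 //;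
  apply/eqP; rewrite iter_sigma_eq0.
Qed.

(** After splitting off a power of 'X, which [y] inverts, the constant term is invertible and the
    coefficients of the quotient are determined recursively from the lower bound [t] upwards. *)
Lemma laurent_divisible p u : p != 0 -> laurent u ->
  exists2 u', laurent u' & ev p *: u' = u.
Proof.
move=> /poly_split_X[s [q [-> q0]]] [t ut].
suff [u' Eu' uE] : exists2 u', laurent u' & ev q *: u' = u.
  exists (y ^+ s *: u'); first by apply: submoduleZ => //; exact: laurent_submodule.
  rewrite skew_evalMXn scalerA -mulrA (_ : x ^+ s * y ^+ s = 1) ?mulr1 //.
  exact: (yX_xX (sl_xy SL)).
(* The equation at index t + m solved for the coefficient [g m]; terms with l > m are absent because
   the series vanishes below [t]. *)
pose step m (g : nat -> K) : K := (q`_0)^-1 * (seq_val u 1 (t + m%:Z) -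
  \sum_(l < size q | (0 < l <= m)%N) q`_l * iter l sigma (g (m - l)%N)).
have [|g gE] := @strong_recursion K 0 step.
  move=> m g g' gg'; rewrite /step; congr (_ * (_ - _)).
  by apply: eq_bigr => l /andP[l0 lm]; rewrite gg' //; lia.
pose e (m : int) : K := if (t <= m)%R then g `|m - t|%N else 0.
exists (laurent_elt e).
  apply: (@laurent_eltP e t) => m mt; rewrite /e ifF //.
  by apply/negbTE; rewrite -Order.TotalTheory.ltNge.
have sigma0 l : iter l sigma 0 = 0 by apply/eqP; rewrite iter_sigma_eq0.
have iter_iota l c z : iter l sigma (iota c * z) = iota c * iter l sigma z.
  by elim: l => // l IHl; rewrite !iterS IHl rmorphM ff_frob_inj.
apply: seq_val_inj => a m; rewrite seq_val_ev (ut a m).2.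
under eq_bigr do rewrite laurent_eltE iter_iota mulrCA.
rewrite -mulr_sumr; congr (_ * _).
have [tm|tm] := Order.TotalTheory.leP t m; last first.
  rewrite (ut 1 m).1 // big1 // => l _; rewrite /e ifF ?sigma0 ?mulr0 //.
  by apply/negbTE; lia.
have [d mE] : exists d : nat, m = t + d%:Z by exists `|m - t|%N; lia.
have q_gt0 : (0 < size q)%N.
  by rewrite size_poly_gt0; apply: contraNneq q0 => ->; rewrite coef0.
rewrite (bigD1 (Ordinal q_gt0)) //= subr0.
have -> : e m = g d by rewrite /e tm; congr g; lia.
rewrite gE /step mulrA divff // mul1r -mE -[RHS](subrK (\sum_(l < size q | (0 < l
  <= d)%N)
  q`_l * iter l sigma (g (d - l)%N))); congr (_ + _).
rewrite [RHS]big_mkcond [LHS]big_mkcond; apply: eq_bigr => l _.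
rewrite -(inj_eq val_inj) /= -lt0n; case: (posnP l) => [//|l0] /=.
case: leqP => ld.
  rewrite /e ifT; last lia.
  by congr (_ * iter l sigma (g _)); lia.
by rewrite /e ifF ?sigma0 ?mulr0 //; apply/negbTE; lia.
Qed.

Lemma operator_ring_not_CSL : (forall y, exists x, f x = y) ->
  (forall x, f x = 0 <-> @jacobson_radical A x) -> ~ has_CSL (@all_modules R^c).
Proof.
move=> f_surj f_ker.
pose u0 := laurent_elt (fun m => (m == 0)%:R).
apply: (divisible_not_CSL (SL := SL) (E := laurent) (i := i0) (u0 := u0) f_surj
  f_ker).
- exact: laurent_submodule.
- apply: (@laurent_eltP _ 0) => m m0; case: eqP => // mE.
  by rewrite mE in m0.
- move=> /(congr1 (fun u : U => seq_val u 1 0)) /= /eqP.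
  rewrite laurent_eltE char_at1 rmorph1 mul1r eqxx; exact/negP/oner_neq0.
- by move=> a u; exact: laurent_alg.
- exact: laurent_torsion_free.
exact: laurent_divisible.
Qed.

End Laurent.
End Realization.

Lemma has_CSL_sub (R : nzRingType) (P : lmodType R -> Prop) :
  has_CSL (@all_modules R) -> has_CSL P.
Proof. by move=> CSL M _; exact: CSL. Qed.

Theorem proposition1p5 (k : finFieldType) (A : falgType k)
  (hA : elementary A) (hQ : right_quiver_totally_disconnected A) :
  exists R : nzRingType,
    noetherian_ring R /\
    equivalent_categories
      (module_category (@finite_length A^c))
      (module_category (@finite_length R^c)) /\
    (has_CSL (@finite_length A^c) /\ has_CSL (@finite_length R^c)) /\
    (has_CSL (@all_modules A^c) /\ ~ has_CSL (@all_modules R^c)).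
Proof.
have [n [f [f_surj f_ker]]] := hA.
have [FF] := frobenius_closure k.
have CSL_A : has_CSL (@all_modules A^c) := elementary_CSL f_surj f_ker hQ.
(* Without any character the radical would contain 1, against its nilpotency. *)
have [i0 _] : exists i0 : 'I_n, True.
  case: n f f_surj f_ker CSL_A => [|n] f f_surj f_ker _; last by exists ord0.
  have [m Jm] := radical_nilpotent f_ker.
  have J1 : (1 : A) \in radical f by apply/radicalP; case.
  have : (1 : A) \in (radical f ^+ m)%VS.
    elim: (m) => [|l IHl]; first by rewrite expv0 memv_line.
    by rewrite -[1 : A]mulr1 expvSl memv_mul.
  by rewrite Jm memv0 oner_eq0.
exists (operator_ring A FF); split; first exact: operator_ring_noetherian.
split.
  apply: (fixed_functor_equivalence f_surj f_ker (SL := operator_skew_laurent A FF)).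
  exact: operator_scalar_extension.
split; split=> //.
- exact: has_CSL_sub.
- exact: (skew_CSL f_surj f_ker (operator_skew_laurent A FF)).
exact: operator_ring_not_CSL i0 f_surj f_ker.
Qed.
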